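(* Let $G$ be a planar graph with girth $g(G)\geq 5$ and maximum degree $\Delta$. Then $\chi_2(G)\leq \Delta+7$.
   Context: All graphs are finite and simple. A 2-distance coloring of $G$ is a vertex coloring in which any two distinct vertices at distance at most $2$ in $G$ receive different colors; $\chi_2(G)$ is the minimum number of colors in a 2-distance coloring of $G$. The girth $g(G)$ is the length of a shortest cycle of $G$. *)

(* Defs.v *)
From mathcomp Require Import all_boot all_order all_algebra.
From mathcomp Require Import all_classical all_reals all_analysis.
Import numFieldNormedType.Exports.

Set Implicit Arguments.
Unset Strict Implicit.
Unset Printing Implicit Defensive.

Import Order.TTheory GRing.Theory Num.Theory.

Record sgraph := SGraph {
  vertex :> finType;
  adj : rel vertex;
  adj_sym : symmetric adj;
  adj_irrefl : irreflexive adj }.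

Definition neighbors (G : sgraph) (v : G) : {set G} := [set w | adj v w].

Definition max_degree (G : sgraph) : nat := \max_(v : G) #|neighbors v|.

(* A walk of length n from u is the sequence of its n vertices after u;
   the distance is at most k iff there is a walk of length at most k. *)
Definition dist_le (G : sgraph) (k : nat) (u v : G) : bool :=
  [exists n : 'I_k.+1, exists p : n.-tuple G, path (@adj G) u p && (last u p == v)].

Definition coloring2 (G : sgraph) (k : nat) (c : {ffun G -> 'I_k}) : bool :=
  [forall u : G, forall v : G, (u != v) && dist_le 2 u v ==> (c u != c v)].

Definition colorable2 (G : sgraph) (k : nat) : bool :=
  [exists c : {ffun G -> 'I_k}, coloring2 c].

Lemma colorable2_card (G : sgraph) : exists k, colorable2 G k.
Proof.
exists #|G|; apply/existsP; exists [ffun v => enum_rank v].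
apply/forallP => u; apply/forallP => v; apply/implyP => /andP[uv _].
by rewrite !ffunE (inj_eq enum_rank_inj).
Qed.

Definition chi2 (G : sgraph) : nat := ex_minn (colorable2_card G).

(* The bound 2 < k is needed: [:: u; v] satisfies ucycle when u and v are
   adjacent. *)
Definition has_cycle (G : sgraph) (k : nat) : bool :=
  (2 < k) && [exists c : k.-tuple G, ucycleb (@adj G) c].

(* None stands for the infinite girth of a forest. *)
Definition girth (G : sgraph) : option nat :=
  if pselect (exists k, has_cycle G k) is left cycG
  then Some (ex_minn cycG) else None.

Definition girth_ge (G : sgraph) (k : nat) : bool :=
  if girth G is Some g then k <= g else true.

Local Open Scope classical_set_scope.
Local Open Scope ring_scope.

Definition arc_between (R : realType) (p q : R * R) (A : set (R * R)) : Prop :=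
  exists f : R -> R * R,
    [/\ {within `[0, 1], continuous f}, {in `[0, 1] &, injective f},
        f @` `[0, 1] = A, f 0 = p & f 1 = q].

(* G can be drawn in the Euclidean plane without crossings: distinct vertices
   are distinct points, the edge uv is a simple arc joining the points of u and
   v that contains no other vertex, and two distinct edges meet only in
   vertices. *)
Definition planar (R : realType) (G : sgraph) : Prop :=
  exists (pt : G -> R * R) (arc : G -> G -> set (R * R)),
    [/\ injective pt,
        forall u v, arc u v = arc v u,
        forall u v, adj u v -> arc_between (pt u) (pt v) (arc u v),
        forall u v w, adj u v -> arc u v (pt w) -> w = u \/ w = v
      & forall u v u' v', adj u v -> adj u' v' ->
          [set u; v]%SET != [set u'; v']%SET ->
          arc u v `&` arc u' v' `<=` range pt].

(* Main.v *)
Require Import Defs.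
From mathcomp Require Import all_boot all_order all_algebra.
From mathcomp Require Import all_classical all_reals all_analysis.
From mathcomp Require Import zify ring lra.
Import numFieldNormedType.Exports.

Set Implicit Arguments.
Unset Strict Implicit.
Unset Printing Implicit Defensive.

Import Order.TTheory GRing.Theory Num.Theory.

(* Let k = D + 7, where D bounds the degrees, and let K be the largest set of
   vertices each of which has at least k vertices of K at distance at most 2.
   The vertices outside K can be coloured last, greedily; hence, if G has a
   minimal number of edges among the graphs that are not colourable, the
   vertices outside K have degree at least 2 and are pairwise nonadjacent, since
   otherwise some edge could be deleted.  A planar graph satisfies
   E - V + 1 <= 2 * (total weight of the edges) for every weighting of the edges
   that gives weight at least 1 to each cycle: over F_2 the boundaries of the
   faces span the cycle space, every edge lies on at most two of them, and every
   nonzero boundary contains a cycle.  The uniform weight 1/5 is not enough when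
   vertices of degree 2 lie in K, but the edges at these vertices may be given
   less weight if some edges at their neighbours, which have many neighbours in
   K, get more; then discharging contradicts the inequality.
   Planarity is used as follows.  The first thirds of the edges at a vertex p
   form a compact set S_p; these sets and the middle thirds of the edges are
   disjoint unless incident, so that the cells of a fine grid that they meet
   exhibit G as a minor of the grid, where a cycle is visibly the boundary of a
   set of corners. *)

(** * Linear algebra *)

Section Duality.
Local Open Scope ring_scope.

(** A maximal independent family of rows of [A] consists of nonzero vectors in the kernel of [B],
    each of weight at least [t], and a column meets at most two of them. The rank of [A] is at least
    the dimension [n - \rank B] of that kernel. *)
Lemma sparse_cycle_bound (m n p : nat) (A : 'M['F_2]_(m, n))
    (B : 'M['F_2]_(n, p)) (w : 'I_n -> nat) (t : nat) :
  (kermx B <= A)%MS -> A *m B = 0 ->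
  (forall j, (#|[set i | A i j != 0%R]| <= 2)%N) ->
  (forall z : 'rV_n, z *m B = 0 -> z != 0 ->
    (t <= \sum_(j | z ord0 j != 0%R) w j)%N) ->
  (t * (n - \rank B) <= 2 * \sum_j w j)%N.
Proof.
move=> kerA AB0 col2 wt.
apply: (@leq_trans (t * \rank A)); first by rewrite leq_mul2l -mxrank_ker mxrankS ?orbT.
pose f := maxrankfun A.
have rowk k : (t <= \sum_(j | A (f k) j != 0%R) w j)%N.
  have := wt (row (f k) A).
  under eq_bigl do rewrite mxE; apply; first by rewrite -row_mul AB0 row0.
  apply/eqP => Ak0; have := maxrowsub_free A; apply/negP/row_freePn.
  exists k; suff -> : row k (rowsub f A) = 0 by rewrite sub0mx.
  by rewrite -Ak0; apply/rowP => j; rewrite !mxE.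
apply: (@leq_trans (\sum_(k < \rank A) \sum_(j | A (f k) j != 0%R) w j)).
  rewrite mulnC -{1}(card_ord (\rank A)) -sum_nat_const.
  by apply: leq_sum => k _.
rewrite (exchange_big_dep xpredT) //= big_distrr /=.
apply: leq_sum => j _; rewrite sum_nat_const leq_mul2r; apply/orP; right.
apply: leq_trans (col2 j).
rewrite -(card_imset _ (@maxrankfun_inj _ _ _ A)).
apply: subset_leq_card; apply/fintype.subsetP => i /imsetP[k]; rewrite inE => ? ->.
by [].
Qed.

(** Rows of coordinate sum 0 supported in [W] are combinations of the differences between the unit
    vectors at the other points of [W] and the one at [v0], so [B] factors through dimension
    [#|W| - 1]. *)
Lemma rank_zero_sum_rows (F : fieldType) (n p : nat) (B : 'M[F]_(n, p))
    (W : {set 'I_p}) (v0 : 'I_p) :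
  v0 \in W -> (forall i, \sum_j B i j = 0) ->
  (forall i j, j \notin W -> B i j = 0) -> (\rank B < #|W|)%N.
Proof.
move=> v0W sum0 supp; rewrite (cardsD1 v0) v0W ltnS.
pose W' := W :\ v0.
suff -> : B = (\matrix_(i < n, k < #|W'|) B i (enum_val k)) *m
              (\matrix_(k < #|W'|, l < p) ((l == enum_val k)%:R - (l == v0)%:R)).
  exact: mulmx_max_rank.
apply/matrixP => i l; rewrite mxE.
under eq_bigr do rewrite !mxE.
rewrite -(big_enum_val (fun x => B i x * ((l == x)%:R - (l == v0)%:R))) /=.
have [-> | lv0] := eqVneq l v0.
  transitivity (- \sum_(x in W') B i x).
    have := sum0 i; rewrite (bigID (mem W)) /= [X in _ + X]big1 ?addr0; last first.
      by move=> j /supp.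
    rewrite (bigD1 v0) //= => /eqP; rewrite addr_eq0 => /eqP->; congr (- _).
    by apply: eq_bigl => j; rewrite !inE andbC.
  rewrite -sumrN; apply: eq_bigr => x; rewrite !inE => /andP[xv0 _].
  by rewrite eq_sym (negbTE xv0) sub0r mulrN1.
under eq_bigr do rewrite subr0 mulr_natr mulrb.
have [lW|lW] := boolP (l \in W'); first last.
  rewrite big1 => [|x xW']; last first.
    by case: eqP => // lx; rewrite lx xW' in lW.
  by apply: supp; move: lW; rewrite !inE lv0.
rewrite (bigD1 l) //= eqxx big1 ?addr0 // => x /andP[_].
by rewrite eq_sym => /negbTE->.
Qed.

End Duality.

(** * Cycles and boundaries in the grid *)

Section Grid.
Local Open Scope ring_scope.

Lemma F2_addxx (x : 'F_2) : x + x = 0.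
Proof. by case: x => [[|[|]]] // p; apply/val_inj. Qed.

Lemma F2_oppr (x : 'F_2) : - x = x.
Proof. by apply/eqP; rewrite eq_sym -addr_eq0 F2_addxx. Qed.

Lemma F2_addr_eq0 (x y : 'F_2) : (x + y == 0) = (x == y).
Proof. by rewrite addr_eq0 F2_oppr. Qed.

Lemma F2_sum_sym (T : finType) (S : {set T}) (c : T -> T -> 'F_2) :
  (forall x y, c x y = c y x) -> (forall x, c x x = 0) ->
  \sum_(x in S) \sum_(y in S) c x y = 0.
Proof.
move=> csym c0; pose r (x y : T) := (enum_rank x < enum_rank y)%N.
transitivity (\sum_(x in S) \sum_(y in S) (c x y *+ r x y + c x y *+ r y x)).
  apply: eq_bigr => x _; apply: eq_bigr => y _; rewrite /r.
  case: (ltngtP (enum_rank x) (enum_rank y)) => [_|_|/val_inj/enum_rank_inj->].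
  - by rewrite addr0.
  - by rewrite add0r.
  - by rewrite c0 !mul0rn addr0.
under eq_bigr do rewrite big_split /=.
rewrite big_split /= [X in _ + X]exchange_big /=.
under [X in _ + X]eq_bigr do under eq_bigr do rewrite csym.
exact: F2_addxx.
Qed.

(** The chain is the sum modulo 2 of the steps of a path; at an inner vertex the boundaries of
    consecutive steps cancel. *)
Lemma connect_chain (T : finType) (r : rel T) (x y : T) :
  symmetric r -> irreflexive r -> connect r x y ->
  exists c : T -> T -> 'F_2,
    [/\ forall u v, c u v = c v u, forall u v, c u v != 0 -> r u v
      & forall u, \sum_v c u v = (u == x)%:R + (u == y)%:R].
Proof.
move=> rsym rirr /connectP[p]; elim: p x => [|x' p IHp] x /=.
  move=> _ ->; exists (fun _ _ => 0); split=> // u.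
  by rewrite F2_addxx big1.
case/andP=> rxx' /IHp{}IHp /IHp[c [csym cr cbd]].
pose d u v : 'F_2 := ((u == x) && (v == x'))%:R + ((u == x') && (v == x))%:R.
exists (fun u v => d u v + c u v); split=> [u v|u v|u].
- by rewrite csym /d addrC [X in _ + X]addrC addrC ![(v == _) && _]andbC.
- rewrite /d; case: (boolP ((u == x) && _)) => [/andP[/eqP-> /eqP->]//|_].
  case: (boolP ((u == x') && _)) => [/andP[/eqP-> /eqP->]|_]; first by rewrite rsym.
  by rewrite !add0r => /cr.
- rewrite big_split /= cbd /d big_split /=.
  have one (a b : T) : \sum_v ((u == a) && (v == b))%:R = (u == a)%:R :> 'F_2.
    rewrite (bigD1 b) //= eqxx andbT big1 ?addr0 // => i /negbTE->.
    by rewrite andbF.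
  rewrite !one -!addrA; congr (_ + _); rewrite addrA F2_addxx add0r //.
Qed.

Variable n : nat.
Notation P := ('I_n.+1 * 'I_n.+1)%type.

Definition px (i j : nat) : P := (inord i, inord j).

Definition rook (x y : P) : bool :=
  (x.1 == y.1) && ((x.2 == y.2.+1 :> nat) || (y.2 == x.2.+1 :> nat)) ||
  (x.2 == y.2) && ((x.1 == y.1.+1 :> nat) || (y.1 == x.1.+1 :> nat)).

Definition interior (x : P) : bool := (0 < x.1 < n)%N && (0 < x.2 < n)%N.

Lemma rook_sym : symmetric rook.
Proof.
move=> x y; rewrite /rook (eq_sym x.1) (eq_sym x.2).
by congr (_ && _ || _ && _); rewrite orbC.
Qed.

Lemma rook_irr : irreflexive rook.
Proof. by move=> x; rewrite /rook !eqxx /=; lia. Qed.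

(* The edge of the grid joining the adjacent pixels x and y separates the
   corners sideL x y and sideR x y; the corner (i, j) is the common vertex of
   the pixels (i, j), (i + 1, j), (i, j + 1) and (i + 1, j + 1). *)
Definition sideL (x y : P) : P := px (minn x.1 y.1) (minn x.2 y.2).
Definition sideR (x y : P) : P :=
  px (minn x.1 y.1 - (x.1 == y.1)) (minn x.2 y.2 - (x.2 == y.2)).

Lemma sideL_sym x y : sideL x y = sideL y x.
Proof. by rewrite /sideL minnC (minnC x.2). Qed.

Lemma sideR_sym x y : sideR x y = sideR y x.
Proof. by rewrite /sideR minnC (minnC x.2) (eq_sym x.1) (eq_sym x.2). Qed.

Lemma px_val (x : P) : px x.1 x.2 = x.
Proof. by case: x => a b; rewrite /px /= !inord_val. Qed.

Lemma px_inj i j i' j' : (i <= n)%N -> (j <= n)%N -> (i' <= n)%N -> (j' <= n)%N ->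
  (px i j == px i' j') = (i == i') && (j == j').
Proof. by move=> *; rewrite /px xpair_eqE -!val_eqE /= !inordK. Qed.

Lemma rook_px i j i' j' :
  (i <= n)%N -> (j <= n)%N -> (i' <= n)%N -> (j' <= n)%N ->
  rook (px i j) (px i' j') =
    (i == i') && ((j == j'.+1) || (j' == j.+1)) ||
    (j == j') && ((i == i'.+1) || (i' == i.+1)).
Proof. by move=> *; rewrite /rook /px -!val_eqE /= !inordK. Qed.

Lemma rook_sum (F : P -> 'F_2) i j : (0 < i < n)%N -> (0 < j < n)%N ->
  (forall y, ~~ rook (px i j) y -> F y = 0) ->
  \sum_y F y = F (px i.+1 j) + F (px i.-1 j) + F (px i j.+1) + F (px i j.-1).
Proof.
move=> Hi Hj F0.
rewrite (bigD1 (px i.+1 j)) //= (bigD1 (px i.-1 j)) /=; last by rewrite px_inj; lia.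
rewrite (bigD1 (px i j.+1)) /=; last by rewrite !px_inj; lia.
rewrite (bigD1 (px i j.-1)) /=; last by rewrite !px_inj; lia.
rewrite big1 ?addr0 ?addrA // => y; rewrite -(px_val y) => Hy.
have Hy1 := ltn_ord y.1; have Hy2 := ltn_ord y.2.
apply: F0; rewrite rook_px; move: Hy; rewrite ?px_inj; lia.
Qed.


Lemma sideL_px i j i' j' :
  (i <= n)%N -> (j <= n)%N -> (i' <= n)%N -> (j' <= n)%N ->
  sideL (px i j) (px i' j') = px (minn i i') (minn j j').
Proof. by move=> *; rewrite /sideL /= !inordK. Qed.

Lemma sideR_px i j i' j' :
  (i <= n)%N -> (j <= n)%N -> (i' <= n)%N -> (j' <= n)%N ->
  sideR (px i j) (px i' j') =
    px (minn i i' - (i == i')) (minn j j' - (j == j')).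
Proof. by move=> *; rewrite /sideR -!val_eqE /= !inordK. Qed.

(** The four edges at an interior pixel cross its four sides, and each of its four corners is an end
    of two sides, so that every value of [psi] occurs twice. *)
Lemma coboundary_closed (psi : P -> 'F_2) (x : P) : interior x ->
  \sum_y (psi (sideL x y) + psi (sideR x y)) *+ rook x y = 0.
Proof.
rewrite /interior -(px_val x).
have := ltn_ord x.1; have := ltn_ord x.2.
move: (x.1 : nat) (x.2 : nat) => {x} i j i_n j_n.
rewrite /px /= !inordK //= => /andP[Hi Hj].
rewrite -/(px i j) (rook_sum Hi Hj); last by move=> y /negbTE->.
have [*] : [/\ i.-1 <= n, j.-1 <= n, i.+1 <= n & j.+1 <= n]%N by split; lia.
rewrite !rook_px // !sideL_px // !sideR_px //.
rewrite !eqxx /= !orbT /=.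
have -> : (j == j.-1.+1) by lia. rewrite /= ?orbT /=.
have -> : (i == i.-1.+1) by lia. rewrite /= ?orbT /= !mulr1n.
have e1 : (i == i.+1) = false by lia.
have e2 : (i == i.-1) = false by lia.
have e3 : (j == j.+1) = false by lia.
have e4 : (j == j.-1) = false by lia.
rewrite e1 e2 e3 e4 !minnn !subn0 !subn1.
have -> : minn i i.+1 = i by lia.
have -> : minn j j.+1 = j by lia.
have -> : minn i i.-1 = i.-1 by lia.
have -> : minn j j.-1 = j.-1 by lia.
set a := psi _; set b := psi _; set c := psi _; set d := psi _.
by rewrite -[RHS](F2_addxx (a + b + c + d)) !addrA; ring.
Qed.

(** The potential of a corner is the parity of the edges of [c] crossed by a straight ray from that
    corner to the border, where [c] vanishes. *)
Lemma closed_coboundary (c : P -> P -> 'F_2) :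
  (forall x y, c x y = c y x) ->
  (forall x y, c x y != 0 -> [&& rook x y, interior x & interior y]) ->
  (forall x, \sum_y c x y = 0) ->
  exists psi : P -> 'F_2, forall x y, rook x y -> interior x ->
    psi (sideL x y) + psi (sideR x y) = c x y.
Proof.
move=> csym csupp cbd.
pose H i j := c (px i j) (px i.+1 j); pose V i j := c (px i j) (px i j.+1).
have c0 x y : ~~ [&& rook x y, interior x & interior y] -> c x y = 0.
  by move=> h; apply/eqP; apply: contraR h; exact: csupp.
have int_px i j : (i <= n)%N -> (j <= n)%N -> interior (px i j) = (0 < i < n)%N && (0 < j < n)%N.
  by move=> *; rewrite /interior /= !inordK.
pose psi (i j : nat) : 'F_2 := \sum_(0 <= k < j.+1) H i k.
exists (fun x : P => psi x.1 x.2) => x y.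
(* Comparing the rays of two neighbouring columns: the induction step is the cycle condition at the
   pixel [px i j.+1], and at the border all terms vanish. *)
have step i j : (0 < i < n)%N -> (j < n)%N -> psi i j + psi i.-1 j = V i j.
  move=> Hi; elim: j => [|j IHj] jn.
    by rewrite /psi !big_nat1 /H /V !c0 ?addr0 // !int_px; lia.
  rewrite /psi big_nat_recr //= [X in _ + X]big_nat_recr //= addrACA.
  rewrite -/(psi i j) -/(psi i.-1 j) IHj; last by lia.
  have Hj : (0 < j.+1 < n)%N by lia.
  have := rook_sum (F := c (px i j.+1)) Hi Hj.
  rewrite cbd => E; apply/eqP; rewrite -F2_addr_eq0 E; last first.
    by move=> y' h; rewrite c0 // (negbTE h).
  rewrite /V /H /= prednK; last by lia.
  rewrite (csym (px i.-1 _)) (csym (px i j)).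
  set a1 := c _ _; set a2 := c _ _; set a3 := c _ _; set a4 := c _ _.
  by apply/eqP; rewrite !addrA; ring.
have stepH i j : (0 < j)%N -> psi i j + psi i j.-1 = H i j.
  case: j => // j _; rewrite /= {1}/psi big_nat_recr //= -/(psi i j).
  by rewrite addrAC F2_addxx add0r.
rewrite -(px_val x) -(px_val y).
have := ltn_ord x.1; have := ltn_ord x.2; have := ltn_ord y.1; have := ltn_ord y.2.
move: (x.1 : nat) (x.2 : nat) (y.1 : nat) (y.2 : nat) => {x y} i j i' j'.
rewrite !ltnS => j'n i'n jn In.
rewrite rook_px // !int_px // sideL_px // sideR_px // => /orP[].
  case/andP=> /eqP <-; rewrite eqxx minnn subn1.
  case/orP=> /eqP ej /andP[Hi Hj].
    have -> : (j == j') = false by lia.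
    have -> : minn j j' = j' by lia.
    rewrite subn0 /= !inordK; try lia.
    rewrite step; try lia.
    by rewrite /V -ej csym.
  have -> : (j == j') = false by lia.
  have -> : minn j j' = j by lia.
  rewrite subn0 /= !inordK; try lia.
  rewrite step; try lia.
  by rewrite /V ej.
case/andP=> /eqP <-; rewrite eqxx minnn subn1.
case/orP=> /eqP ei /andP[Hi Hj].
  have -> : (i == i') = false by lia.
  have -> : minn i i' = i' by lia.
  rewrite subn0 /= !inordK; try lia.
  rewrite stepH; last by lia.
  by rewrite /H -ei csym.
have -> : (i == i') = false by lia.
have -> : minn i i' = i by lia.
rewrite subn0 /= !inordK; try lia.
rewrite stepH; last by lia.
by rewrite /H ei.
Qed.

End Grid.

(** * Cycle space and faces of a minor of the grid *)

Section Minor.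
Local Open Scope ring_scope.
Variables (V : finType) (n : nat).
Notation P := ('I_n.+1 * 'I_n.+1)%type.
Variables (Es : {set V * V}) (B : V -> {set P}) (b : V -> P) (ex ey : V * V -> P).
Hypothesis Es_irr : forall e, e \in Es -> e.1 != e.2.
Hypothesis Es_asym : forall e, e \in Es -> (e.2, e.1) \notin Es.
Hypothesis B_int : forall p x, x \in B p -> interior x.
Hypothesis B_disj : forall p q x, x \in B p -> x \in B q -> p = q.
Hypothesis B_conn : forall p x, x \in B p ->
  connect [rel u v | [&& rook u v, u \in B p & v \in B p]] (b p) x.
Hypothesis exB : forall e, e \in Es -> ex e \in B e.1.
Hypothesis eyB : forall e, e \in Es -> ey e \in B e.2.
Hypothesis ex_ey : forall e, e \in Es -> rook (ex e) (ey e).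

(** Grid edges that are not [kept] are deleted: crossing one does not change the face, so a face of
    the minor is a class of corners under [same_face], represented by its root in [faceL] and
    [faceR]. *)
Definition kept (x y : P) : bool :=
  [exists p, (x \in B p) && (y \in B p)] ||
  [exists e in Es, (x == ex e) && (y == ey e) || (x == ey e) && (y == ex e)].

Lemma edge_pos_inj e e' : e \in Es -> e' \in Es ->
  ex e \in B e'.1 -> ey e \in B e'.2 -> e = e'.
Proof.
move=> eE e'E /(B_disj (exB eE)) e1 /(B_disj (eyB eE)) e2.
by case: e e' e1 e2 {eE e'E} => [? ?] [? ?] /= -> ->.
Qed.

Lemma edge_pos_swap e e' : e \in Es -> e' \in Es ->
  ex e \in B e'.2 -> ey e \in B e'.1 -> False.
Proof.
move=> eE e'E /(B_disj (exB eE)) e1 /(B_disj (eyB eE)) e2.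
by have := Es_asym e'E; rewrite -e1 -e2 -surjective_pairing eE.
Qed.

Definition same_face (u v : P) : bool :=
  [exists x : P, exists y : P, [&& rook x y, interior x, ~~ kept x y
    & (u == sideL x y) && (v == sideR x y) ||
      (v == sideL x y) && (u == sideR x y)]].

Lemma same_face_sym : symmetric same_face.
Proof.
by move=> u v; apply: eq_existsb => x; apply: eq_existsb => y; rewrite orbC.
Qed.

Definition faceL (e : V * V) : P := fingraph.root same_face (sideL (ex e) (ey e)).
Definition faceR (e : V * V) : P := fingraph.root same_face (sideR (ex e) (ey e)).

(** Summing [coboundary_closed] over the pixels of [B p] leaves only the grid edges that leave
    [B p]; among these the deleted ones contribute 0, and the kept ones are the edges of the graph
    at [p]. *)
Lemma face_boundary_closed (phi : P -> 'F_2) (p : V) :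
  \sum_(e in Es) (phi (faceL e) + phi (faceR e)) *+ ((e.1 == p) + (e.2 == p)) = 0.
Proof.
pose psi x := phi (fingraph.root same_face x).
pose c x y := (psi (sideL x y) + psi (sideR x y)) *+ rook x y.
have csym x y : c x y = c y x by rewrite /c sideL_sym sideR_sym rook_sym.
have cxx x : c x x = 0 by rewrite /c rook_irr.
have ckept x y : interior x -> ~~ kept x y -> c x y = 0.
  move=> xi nk; rewrite /c; case: (boolP (rook x y)) => // r; rewrite mulr1n.
  apply/eqP; rewrite F2_addr_eq0 /psi; apply/eqP; congr phi.
  apply/eqP; rewrite fingraph.root_connect; last exact/sym_connect_sym/same_face_sym.
  apply/connect1/existsP; exists x; apply/existsP; exists y.
  by rewrite r xi nk !eqxx.
have: \sum_(x in B p) \sum_y c x y = 0.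
  by apply: big1 => x /B_int; exact: coboundary_closed.
under eq_bigr do rewrite (bigID (mem (B p))) /=.
(* Grid edges inside [B p] are counted from both ends and cancel. *)
rewrite big_split /= F2_sum_sym // add0r => E.
rewrite -[RHS]E.
pose ind e x y : nat :=
  (((x == ex e) && (y == ey e)) + ((x == ey e) && (y == ex e)))%N.
transitivity (\sum_(x in B p) \sum_(y | y \notin B p) \sum_(e in Es) c x y *+ ind e x y).
  rewrite [RHS](eq_bigr (fun x => \sum_(e in Es) \sum_(y | y \notin B p)
      c x y *+ ind e x y)); last by move=> x _; exact: exchange_big.
  rewrite [RHS]exchange_big /=; apply: eq_bigr => e eE; apply/esym.
  have pick (u v : P) : \sum_(x in B p) \sum_(y | y \notin B p)
      c x y *+ ((x == u) && (y == v)) = c u v *+ ((u \in B p) && (v \notin B p)).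
    rewrite pair_big_dep /=; case: (boolP (_ && _)) => uv.
      rewrite (bigD1 (u, v)) //= !eqxx big1 ?addr0 // => -[x y] /= /andP[_].
      by rewrite xpair_eqE => /negbTE->.
    rewrite big1 // => -[x y] /=; case: (x =P u) => [->|//]; case: (y =P v) => [->|] //=.
    by rewrite (negbTE uv).
  under eq_bigr do under eq_bigr do rewrite /ind mulrnDr.
  under eq_bigr do rewrite big_split /=.
  rewrite big_split /= !pick (csym (ey e)) -mulrnDr /c (ex_ey eE) mulr1n.
  congr (_ *+ _).
  have inB x q : x \in B q -> (x \in B p) = (q == p).
    by move=> xq; apply/idP/eqP => [/(B_disj xq)//|<-].
  rewrite (inB _ _ (exB eE)) (inB _ _ (eyB eE)).
  have := Es_irr eE.
  by case: (e.1 =P p) => [->|_]; case: (e.2 =P p) => [->|_] //=; rewrite ?eqxx.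
apply: eq_bigr => x xB; apply: eq_bigr => y yB.
rewrite sumrMnr.
have [[e eE xy]|no] := pselect (exists2 e, e \in Es &
    (x == ex e) && (y == ey e) || (x == ey e) && (y == ex e)); last first.
  have no_ind e : e \in Es -> ind e x y = 0%N.
    move=> eE; apply/eqP; rewrite addn_eq0 !eqb0 -negb_or.
    by apply/negP => h; apply: no; exists e.
  rewrite big1 // mulr0n ckept ?(B_int xB) //; apply/norP; split.
    apply/negP => /existsP[q /andP[xq]].
    by rewrite -(B_disj xB xq) (negbTE yB).
  by apply/negP => /existsP[e /andP[eE xy]]; apply: no; exists e.
(* As the branch sets are disjoint, a kept grid edge leaving [B p] realises exactly one edge of the
   graph. *)
suff -> : (\sum_(e' in Es) ind e' x y = 1)%N by [].
have xyF : ~ (x \in B p /\ y \in B p) by case=> _; rewrite (negbTE yB).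
have exy := ex_ey eE.
have ind1 : ind e x y = 1%N.
  have exey : ex e != ey e by apply: contraTneq exy => ->; rewrite rook_irr.
  rewrite /ind; case/orP: xy => /andP[/eqP-> /eqP->]; rewrite !eqxx /=.
    by rewrite (negbTE exey).
  by rewrite eq_sym (negbTE exey).
rewrite (bigD1 e) //= ind1 big1 ?addn0 // => e' /andP[e'E e'e].
apply/eqP; rewrite addn_eq0 !eqb0 -negb_or; apply: contra e'e => xy'.
apply/eqP/esym.
case/orP: xy => /andP[/eqP xe /eqP ye]; case/orP: xy' => /andP[/eqP xe' /eqP ye'].
- by apply: edge_pos_inj; rewrite // -?xe -?ye ?xe' ?ye' ?exB ?eyB.
- by exfalso; apply: (@edge_pos_swap e e'); rewrite // -?xe -?ye ?xe' ?ye' ?exB ?eyB.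
- by exfalso; apply: (@edge_pos_swap e e'); rewrite // -?xe -?ye ?xe' ?ye' ?exB ?eyB.
- by apply: edge_pos_inj; rewrite // -?xe -?ye ?xe' ?ye' ?exB ?eyB.
Qed.

(** The chain runs from [b e.1] inside [B e.1] to [ex e], crosses to [ey e], and continues inside
    [B e.2] to [b e.2]. The last clause says that it crosses between branch sets at [e] only, so [z]
    can be read off from a sum of such chains. *)
Lemma edge_chain e : e \in Es -> exists c : P -> P -> 'F_2,
  [/\ forall u v, c u v = c v u,
      forall u v, c u v != 0 -> [&& rook u v, interior u, interior v & kept u v],
      forall u, \sum_v c u v = (u == b e.1)%:R + (u == b e.2)%:R
    & forall e', e' \in Es -> c (ex e') (ey e') = (e' == e)%:R].
Proof.
move=> eE.
pose r p : rel P := [rel u v | [&& rook u v, u \in B p & v \in B p]].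
have rsym p : symmetric (r p).
  by move=> u v; rewrite /r /= rook_sym andbA andbAC -andbA.
have rirr p : irreflexive (r p) by move=> u; rewrite /r /= rook_irr.
have [c1 [c1s c1r c1b]] := connect_chain (rsym e.1) (rirr e.1) (B_conn (exB eE)).
have [c2 [c2s c2r c2b]] := connect_chain (rsym e.2) (rirr e.2) (B_conn (eyB eE)).
pose s : rel P := [rel u v | (u == ex e) && (v == ey e) || (u == ey e) && (v == ex e)].
have exey : ex e != ey e by apply: contraTneq (ex_ey eE) => ->; rewrite rook_irr.
have ssym : symmetric s by move=> u v; rewrite /s /= orbC ![(u == _) && _]andbC.
have sirr : irreflexive s.
  by move=> u; rewrite /s /=; case: (u =P ex e) => [->|_]; rewrite ?(negbTE exey) ?andbF.
have /(connect_chain ssym sirr)[c3 [c3s c3r c3b]] : connect s (ex e) (ey e).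
  by apply: connect1; rewrite /s /= !eqxx.
exists (fun u v => c1 u v + c2 u v + c3 u v); split.
- by move=> u v; rewrite c1s c2s c3s.
- have keep p u v : r p u v -> [&& rook u v, interior u, interior v & kept u v].
    case/and3P=> -> uB vB; rewrite (B_int uB) (B_int vB) /=.
    by apply/orP; left; apply/existsP; exists p; rewrite uB.
  move=> u v; have [/c1r/keep //|/negPn/eqP->] := boolP (c1 u v != 0).
  have [/c2r/keep //|/negPn/eqP->] := boolP (c2 u v != 0).
  rewrite !add0r => /c3r suv.
  have k : kept u v by apply/orP; right; apply/existsP; exists e; rewrite eE.
  rewrite k andbT; case/orP: suv => /andP[/eqP-> /eqP->].
    by rewrite (ex_ey eE) (B_int (exB eE)) (B_int (eyB eE)).
  by rewrite rook_sym (ex_ey eE) (B_int (exB eE)) (B_int (eyB eE)).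
- move=> u; rewrite !big_split /= c1b c2b c3b.
  set x1 := (u == ex e)%:R; set x2 := (u == ey e)%:R.
  transitivity ((u == b e.1)%:R + (u == b e.2)%:R + (x1 + x1) + (x2 + x2) : 'F_2).
    by ring.
  by rewrite !F2_addxx !addr0.
- move=> e' e'E.
  have off p (c : P -> P -> 'F_2) : (forall u v, c u v != 0 -> r p u v) ->
      c (ex e') (ey e') = 0.
    move=> cr; apply/eqP; apply: contraT => /cr /and3P[_ h1 h2].
    have := Es_irr e'E.
    by rewrite (B_disj (exB e'E) h1) (B_disj (eyB e'E) h2) eqxx.
  rewrite (off _ _ c1r) (off _ _ c2r) !add0r.
  have [->|ee'] := eqVneq e' e.
    have := c3b (ex e); rewrite (bigD1 (ey e)) //= big1 ?addr0.
      by rewrite eqxx (negbTE exey) addr0 => ->.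
    move=> v vy; apply/eqP; apply: contraT => /c3r; rewrite /s /= eqxx (negbTE vy).
    by rewrite (negbTE exey).
  apply/eqP; apply: contraT => /c3r /orP[] /andP[/eqP h1 /eqP h2].
    by move: ee'; rewrite (@edge_pos_inj e' e) ?eqxx // ?h1 ?h2 ?exB ?eyB.
  by exfalso; apply: (@edge_pos_swap e' e); rewrite // ?h1 ?h2 ?exB ?eyB.
Qed.

(** Replacing each edge of [z] by its chain gives a cycle of the grid, since the base points [b p]
    cancel. Its potential does not change across deleted edges, hence is a function of the face. *)
Lemma cycle_is_face_boundary (z : V * V -> 'F_2) :
  (forall p, \sum_(e in Es) z e *+ ((e.1 == p) + (e.2 == p)) = 0) ->
  exists phi : P -> 'F_2, forall e, e \in Es -> z e = phi (faceL e) + phi (faceR e).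
Proof.
move=> zbd.
(* Pairs that are not edges get the zero chain, as [choice] asks for a total function. *)
have /choice[ch chP] : forall e, exists c : P -> P -> 'F_2, e \in Es ->
  [/\ forall u v, c u v = c v u,
      forall u v, c u v != 0 -> [&& rook u v, interior u, interior v & kept u v],
      forall u, \sum_v c u v = (u == b e.1)%:R + (u == b e.2)%:R
    & forall e', e' \in Es -> c (ex e') (ey e') = (e' == e)%:R].
  move=> e; have [/edge_chain[c ?]|_] := boolP (e \in Es); first by exists c.
  by exists (fun _ _ => 0).
pose c u v := \sum_(e in Es) z e * ch e u v.
have csupp u v : c u v != 0 -> [&& rook u v, interior u, interior v & kept u v].
  apply: contraR => h; apply/eqP; apply: big1 => e eE; have [_ sup _ _] := chP e eE.
  have [/sup|/negPn/eqP->] := boolP (ch e u v != 0); first by rewrite (negbTE h).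
  by rewrite mulr0.
have [||u|psi psiP] := @closed_coboundary n c.
- by move=> u v; apply: eq_bigr => e eE; have [-> _ _ _] := chP e eE.
- by move=> u v /csupp /and4P[-> -> ->].
- rewrite exchange_big /=.
  transitivity (\sum_(e in Es) \sum_p
      (z e *+ ((e.1 == p) + (e.2 == p))) * (u == b p)%:R).
    apply: eq_bigr => e eE; rewrite -big_distrr /=; have [_ _ -> _] := chP e eE.
    under eq_bigr do rewrite mulrnDr mulrDl.
    rewrite big_split /=.
    have pick q : \sum_p (z e *+ (q == p)) * (u == b p)%:R = z e * (u == b q)%:R.
      rewrite (bigD1 q) //= eqxx mulr1n big1 ?addr0 // => p /negbTE.
      by rewrite eq_sym => ->; rewrite mul0r.
    by rewrite !pick mulrDr.
  rewrite exchange_big /= big1 // => p _.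
  by rewrite -big_distrl /= zbd mul0r.
have psi_face u v : same_face u v -> psi u = psi v.
  case/existsP=> x /existsP[y /and4P[rxy xi nk uv]].
  have cxy : c x y = 0.
    by apply/eqP; apply: contraR nk => /csupp /and4P[].
  have /eqP := psiP x y rxy xi; rewrite cxy F2_addr_eq0 => /eqP.
  by case/orP: uv => /andP[/eqP-> /eqP->].
have psi_root u : psi (fingraph.root same_face u) = psi u.
  have gen p w : path same_face w p -> psi (last w p) = psi w.
    by elim: p w => //= v p IHp w /andP[/psi_face -> /IHp].
  by have /connectP[p /gen pE ->] := connect_root same_face u.
exists psi => e eE; rewrite /faceL /faceR !psi_root psiP ?ex_ey //; last first.
  exact: B_int (exB eE).
rewrite /c (bigD1 e) //= big1 => [|e' /andP[e'E e'e]].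
  by have [_ _ _ ->] := chP e eE; rewrite // eqxx mulr1 addr0.
have [_ _ _ ->] := chP e' e'E; rewrite // eq_sym (negbTE e'e) mulr0 //.
Qed.

End Minor.

(** * A weighted Euler inequality *)

Section WeightedEuler.
Variable V : finType.

Definition oriented (S : rel V) : {set V * V} :=
  [set e : V * V | S e.1 e.2 && (enum_rank e.1 < enum_rank e.2)].

Lemma sum_oriented (S : rel V) (f : V -> V -> nat) :
  symmetric S -> irreflexive S -> (forall u v, f u v = f v u) ->
  \sum_u \sum_(v | S u v) f u v = 2 * \sum_(e in oriented S) f e.1 e.2.
Proof.
move=> Ssym Sirr fsym; rewrite pair_big_dep /=.
rewrite (bigID (fun e : V * V => enum_rank e.1 < enum_rank e.2)) /= mul2n -addnn.
congr (_ + _); first by apply: eq_bigl => e; rewrite inE.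
rewrite (reindex_inj (h := fun e : V * V => (e.2, e.1))) /=; last first.
  by move=> [a b] [c d] [-> ->].
apply: eq_big => [e|e _] /=; last by rewrite fsym.
rewrite inE Ssym -leqNgt leq_eqVlt; case: eqP => //= /val_inj/enum_rank_inj ->.
by rewrite Sirr.
Qed.

Lemma F2_natr_odd k : (k%:R = (odd k)%:R :> 'F_2)%R.
Proof.
elim: k => //= k IHk; rewrite -natr1 IHk.
by case: (odd k); rewrite //= ?add0r // F2_addxx.
Qed.

Lemma F2_neq0 (x : 'F_2) : (x = (x != 0)%:R)%R.
Proof. by case: x => [[|[|]]] // i; apply/val_inj. Qed.

Variable adj : rel V.
Hypothesis adj_sym : symmetric adj.
Hypothesis adj_irr : irreflexive adj.

(* F is the set of faces, and the edge e lies between the faces l e and r e: the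
   cycles are exactly the boundaries of the sets of faces. *)
Definition has_dual : Prop :=
  exists (F : finType) (l r : V * V -> F),
  (forall z : V * V -> 'F_2,
     (forall p, \sum_(e in oriented adj) z e *+ ((e.1 == p) + (e.2 == p)) = 0)%R ->
     exists phi : F -> 'F_2,
       forall e, e \in oriented adj -> z e = (phi (l e) + phi (r e))%R) /\
  (forall (phi : F -> 'F_2) p,
     \sum_(e in oriented adj) (phi (l e) + phi (r e)) *+ ((e.1 == p) + (e.2 == p))
       = 0)%R.

(** These are the supports of the nonzero elements of the cycle space over ['F_2]. *)
Definition even_subgraph (S : rel V) : Prop :=
  [/\ symmetric S, subrel S adj, exists u v, S u v
    & forall u, ~~ odd #|[set v : V | S u v]|].

(** Ordered pairs are summed, so every edge of a symmetric [S] counts twice. *)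
Definition edge_weight (m : V -> V -> nat) (S : rel V) : nat :=
  \sum_u \sum_(v | S u v) m u v.

(** This is t * (E - V + 1) <= 2 * (total weight), doubled and free of subtraction, where V counts
    the vertices that are not isolated. It is [sparse_cycle_bound] for the face-edge matrix [A] and
    the edge-vertex matrix [B], whose rank is less than V. *)
Lemma weighted_euler (m : V -> V -> nat) (t : nat) :
  has_dual -> (forall u v, m u v = m v u) ->
  (forall S, even_subgraph S -> 2 * t <= edge_weight m S) ->
  (exists u v, adj u v) ->
  t * \sum_v #|[set u : V | adj v u]| + 2 * t <=
  2 * t * #|[set v : V | [exists u, adj v u]]| + 2 * edge_weight m adj.
Proof.
move=> [F [l [r [cyc bnd]]]] msym tm [u0 [v0 uv0]].
set Es := oriented adj; set W := [set v : V | _].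
have [e0 e0E] : exists e, e \in Es.
  case: (ltngtP (enum_rank u0) (enum_rank v0)) => [lt|lt|/val_inj/enum_rank_inj eq].
  - by exists (u0, v0); rewrite inE uv0.
  - by exists (v0, u0); rewrite inE adj_sym uv0.
  - by rewrite eq adj_irr in uv0.
pose N := #|Es|; pose ev (i : 'I_N) := enum_val i.
have evE i : ev i \in Es by exact: enum_valP.
pose rk := enum_rank_in e0E.
pose inc (e : V * V) (p : V) : nat := (e.1 == p) + (e.2 == p).
pose B := (\matrix_(i < N, j < #|V|) (inc (ev i) (enum_val j))%:R : 'M['F_2]_(N, #|V|))%R.
(* An edge with the same face on both sides gets 1 + 1 = 0, so a row of [A] is the boundary of a
   face modulo 2. *)
pose A := (\matrix_(f < #|F|, i < N) ((enum_val f == l (ev i))%:R + (enum_val f == r (ev i))%:R)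
   : 'M['F_2]_(#|F|, N))%R.
have sumE (x : V * V -> 'F_2) : (\sum_(i < N) x (ev i) = \sum_(e in Es) x e)%R.
  by rewrite [RHS]big_enum_val.
have zB (z : 'rV['F_2]_N) : (z *m B = 0)%R -> forall p,
    (\sum_(e in Es) z ord0 (rk e) *+ inc e p = 0)%R.
  move=> z0 p; have /rowP/(_ (enum_rank p)) := z0; rewrite !mxE => E.
  rewrite -[RHS]E -(sumE (fun e => z ord0 (rk e) *+ inc e p)%R); apply: eq_bigr => i _.
  by rewrite !mxE enum_rankK mulr_natr /rk /ev enum_valK_in.
have kerA : (kermx B <= A)%MS.
  apply/row_subP => i; set z := row i _.
  have z0 : (z *m B = 0)%R by rewrite -row_mul mulmx_ker row0.
  have [phi phiP] := cyc _ (zB z z0).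
  suff -> : z = ((\row_(f < #|F|) phi (enum_val f)) *m A)%R by exact: submxMl.
  apply/rowP => j; rewrite [RHS]mxE.
  have := phiP _ (evE j); rewrite /rk /ev enum_valK_in => ->.
  under eq_bigr do rewrite !mxE mulrDr.
  have pick (g : F) : (\sum_(f < #|F|) phi (enum_val f) * (enum_val f == g)%:R = phi g)%R.
    rewrite (bigD1 (enum_rank g)) //= enum_rankK eqxx mulr1 big1 ?addr0 // => f fg.
    have [gE|] := eqVneq (enum_val f) g; last by rewrite mulr0.
    by rewrite -gE enum_valK eqxx in fg.
  by rewrite big_split /= !pick.
have AB0 : (A *m B = 0)%R.
  apply/matrixP => f j; rewrite !mxE.
  rewrite -[RHS](bnd (fun g => (enum_val f == g)%:R%R) (enum_val j)) -[RHS]sumE.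
  by apply: eq_bigr => i _; rewrite !mxE mulr_natr.
have col2 j : #|[set i | A i j != 0%R]| <= 2.
  have sub : [set i | A i j != 0%R] \subset
      [set enum_rank (l (ev j)); enum_rank (r (ev j))].
    apply/fintype.subsetP => f; rewrite !inE !mxE; apply: contraR.
    rewrite negb_or => /andP[fl fr].
    have ne g : f != enum_rank g -> (enum_val f == g) = false.
      by move=> h; apply: contraNF h => /eqP <-; rewrite enum_valK.
    by rewrite !ne // addr0.
  apply: leq_trans (subset_leq_card sub) _.
  by rewrite cards2; case: (_ != _).
pose w (i : 'I_N) := m (ev i).1 (ev i).2.
(* The support of [z], made symmetric, is an even subgraph: the coordinate of [z *m B] at a vertex
   is the parity of its degree. *)
have wt (z : 'rV['F_2]_N) : (z *m B = 0)%R -> z != 0%R ->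
    t <= \sum_(j | z ord0 j != 0%R) w j.
  move=> z0 zn0.
  pose zf e := z ord0 (rk e).
  pose T e := (e \in Es) && (zf e != 0%R).
  pose S : rel V := [rel u v | T (u, v) || T (v, u)].
  have Tlt e : T e -> enum_rank e.1 < enum_rank e.2.
    by case/andP; rewrite inE => /andP[].
  have Tadj e : T e -> adj e.1 e.2 by case/andP; rewrite inE => /andP[].
  have Ssym : symmetric S by move=> u v; rewrite /S /= orbC.
  have Sirr : irreflexive S.
    by move=> u; rewrite /S /= orbb; apply/negP => /Tlt; rewrite ltnn.
  have Seven : even_subgraph S.
    split=> //.
    - by move=> u v /orP[] /Tadj //=; rewrite adj_sym.
    - have [j zj] : exists j, z ord0 j != 0%R.
        apply/existsP; apply: contraNT zn0 => /existsPn h.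
        by apply/eqP/rowP => j; rewrite mxE; apply/eqP; rewrite -[_ == _]negbK h.
      exists (ev j).1, (ev j).2; rewrite /S /= -surjective_pairing /T evE.
      by rewrite /zf /rk /ev enum_valK_in zj.
    - move=> u; have := zB z z0 u.
      have split2 (e : V * V) : (z ord0 (rk e) *+ inc e u =
          \sum_v (zf e *+ (e == (u, v)) + zf e *+ (e == (v, u))))%R.
        rewrite big_split /= mulrnDr; case: e => a b /=.
        have pick (c d : V) : (\sum_v zf (a, b) *+ ((c == u) && (d == v)) =
            z ord0 (rk (a, b)) *+ (c == u))%R.
          rewrite (bigD1 d) //= eqxx andbT big1 ?addr0 // => i /negbTE.
          by rewrite eq_sym => ->; rewrite andbF.
        congr (_ + _)%R; first rewrite -(pick a b); last rewrite -(pick b a).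
          by apply: eq_bigr => v _; rewrite xpair_eqE.
        by apply: eq_bigr => v _; rewrite xpair_eqE andbC.
      under eq_bigr do rewrite split2.
      rewrite exchange_big /= => sum0.
      have : ((#|[set v : V | S u v]|)%:R = 0 :> 'F_2)%R.
        rewrite -[RHS]sum0 -sum1_card natr_sum big_mkcond /=; apply: eq_bigr => v _.
        rewrite inE big_split /=.
        have pick e : (\sum_(i in Es) zf i *+ (i == e) = (T e)%:R)%R.
          rewrite /T; case: (boolP (e \in Es)) => eE /=.
            rewrite (bigD1 e) //= eqxx -F2_neq0 big1 ?addr0 // => i /andP[_].
            by move=> /negbTE->.
          rewrite big1 // => i iE; case: eqP => // ie; by rewrite -ie iE in eE.
        rewrite !pick /S /=.
        case: (boolP (T (u, v))) => /= T1; last first.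
          by rewrite add0r; case: (T _).
        case: (boolP (T (v, u))) => /= T2; last by rewrite addr0.
        by have := Tlt _ T1; have /= := Tlt _ T2; lia.
      by rewrite F2_natr_odd; case: odd.
  have := tm S Seven; rewrite /edge_weight sum_oriented // leq_pmul2l //.
  congr (_ <= _).
  have -> : \sum_(e in oriented S) m e.1 e.2 = \sum_(e in Es | zf e != 0%R) m e.1 e.2.
    apply: eq_bigl => -[a b]; rewrite inE /= -/(T (a, b)).
    apply/andP/idP => [[/orP[//|/Tlt /=] h1 h2]|Tab]; first by lia.
    by split; [rewrite /S /= Tab | exact: Tlt Tab].
  rewrite big_mkcondr /= [LHS](big_enum_val (fun e => if zf e != 0%R then m e.1 e.2 else 0)).
  rewrite [RHS]big_mkcond /=; apply: eq_bigr => i _.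
  by rewrite /zf /rk /w /ev enum_valK_in.
have main := sparse_cycle_bound kerA AB0 col2 wt.
have u0W : enum_rank u0 \in [set enum_rank v | v in W].
  by apply: imset_f; rewrite inE; apply/existsP; exists v0.
have rowsum i : (\sum_j B i j = 0)%R.
  transitivity (\sum_(p : V) (inc (ev i) p)%:R : 'F_2)%R.
    rewrite [RHS](reindex (@enum_val V predT)) /=; last first.
      by apply: onW_bij; exact: enum_val_bij.
    by apply: eq_bigr => j _; rewrite mxE.
  under eq_bigr do rewrite natrD.
  rewrite big_split /=.
  have pick (q : V) : (\sum_(p : V) (q == p)%:R = 1 :> 'F_2)%R.
    by rewrite (bigD1 q) //= eqxx big1 ?addr0 // => p; rewrite eq_sym => /negbTE->.
  by rewrite !pick F2_addxx.
have suppB i j : j \notin [set enum_rank v | v in W] -> B i j = 0%R.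
  move=> jW; rewrite mxE /inc; have := evE i; rewrite inE => /andP[aE _].
  have ne v : v \in W -> (v == enum_val j) = false.
    move=> vW; apply: contraNF jW => /eqP vj; apply/imsetP.
    by exists v; rewrite // vj enum_valK.
  rewrite !ne // inE; apply/existsP; first by exists (ev i).1; rewrite adj_sym.
  by exists (ev i).2.
have rkB : \rank B < #|W|.
  by rewrite -(card_imset _ enum_rank_inj); exact: rank_zero_sum_rows u0W rowsum suppB.
have -> : \sum_v #|[set u : V | adj v u]| = 2 * N.
  transitivity (\sum_v \sum_(u | adj v u) 1).
    by apply: eq_bigr => v _; rewrite sum1_card cardsE.
  by rewrite sum_oriented // sum1_card.
rewrite /edge_weight sum_oriented //.
have -> : \sum_(e in oriented adj) m e.1 e.2 = \sum_j w j.
  by rewrite (big_enum_val (fun e => m e.1 e.2)).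
have : t * (N + 1) <= t * (N - \rank B + #|W|)
  by rewrite leq_mul2l; apply/orP; right; clear -rkB; lia.
rewrite !mulnDr; nia.
Qed.

End WeightedEuler.

(** * From a drawing to a minor of the grid *)

Section Regions.

(** Every vertex on a path from [a] is itself reachable from [a], so the path stays in the
    component. *)
Lemma connect_component (T : finType) (r : rel T) (a x : T) : connect r a x ->
  connect [rel u v | [&& r u v, connect r a u & connect r a v]] a x.
Proof.
case/connectP=> p; elim/last_ind: p x => [|p y IHp] x.
  by move=> _ ->; exact: connect0.
rewrite rcons_path last_rcons => /andP[pth ry] ->.
apply: connect_trans (IHp _ pth erefl) _; apply: connect1 => /=.
have ap : connect r a (last a p) by apply/connectP; exists p.
by rewrite ry ap (connect_trans ap (connect1 ry)).
Qed.

Variables (V : finType) (n : nat).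
Notation P := ('I_n.+1 * 'I_n.+1)%type.

Definition rook_in (A : {set P}) : rel P :=
  [rel u v | [&& rook u v, u \in A & v \in A]].

Lemma rook_in_mem (A : {set P}) a x : a \in A -> connect (rook_in A) a x -> x \in A.
Proof.
move=> aA /connectP[p]; elim: p a aA => [|y p IHp] a aA /= => [_ -> //|].
by case/andP=> /and3P[_ _ yA]; exact: IHp.
Qed.

Lemma rook_in_sub (A B : {set P}) a x :
  (forall y, connect (rook_in A) a y -> y \in B) ->
  connect (rook_in A) a x -> connect (rook_in B) a x.
Proof.
move=> AB /connect_component; apply: connect_sub => u v /= /and3P[ruv au av].
by apply: connect1; case/and3P: ruv => ruv _ _; rewrite /rook_in /= ruv !AB.
Qed.

Variables (Es : {set V * V}) (NS : V -> {set P}) (NM : V * V -> {set P}).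
Variables (b : V -> P) (x0 y0 : V * V -> P).
Hypothesis Es_irr : forall e, e \in Es -> e.1 != e.2.
Hypothesis NS_int : forall p x, x \in NS p -> interior x.
Hypothesis NM_int : forall e x, e \in Es -> x \in NM e -> interior x.
Hypothesis NS_disj : forall p q x, x \in NS p -> x \in NS q -> p = q.
Hypothesis NM_disj : forall e e' x, e \in Es -> e' \in Es ->
  x \in NM e -> x \in NM e' -> e = e'.
Hypothesis NS_NM : forall p e x, e \in Es -> x \in NS p -> x \in NM e ->
  p = e.1 \/ p = e.2.
Hypothesis bNS : forall p, b p \in NS p.
Hypothesis conn1 : forall e, e \in Es -> connect (rook_in (NS e.1)) (b e.1) (x0 e).
Hypothesis conn2 : forall e, e \in Es -> connect (rook_in (NS e.2)) (b e.2) (y0 e).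
Hypothesis connM : forall e, e \in Es -> connect (rook_in (NM e)) (x0 e) (y0 e).
Hypothesis x0NM : forall e, e \in Es -> x0 e \in NM e.

(** The branch set of [p] is the component [B0 p] of its base point, together with, for each edge
    [e] leaving [p], the part [C e] of the middle region that can be reached before touching
    [B0 e.2]. Thus a whole middle region is given to the first end. *)
Let B0 p : {set P} := [set x | connect (rook_in (NS p)) (b p) x].
Let NC e : {set P} := NM e :\: B0 e.2.
Let C e : {set P} := [set x | connect (rook_in (NC e)) (x0 e) x].
Let B p : {set P} := B0 p :|: \bigcup_(e in Es | e.1 == p) C e.

Let B0_NS p x : x \in B0 p -> x \in NS p.
Proof. by rewrite inE; exact/rook_in_mem/bNS. Qed.

Let x0NC e : e \in Es -> x0 e \in NC e.
Proof.
move=> eE; rewrite inE x0NM // andbT; apply/negP => /B0_NS h.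
have h' := rook_in_mem (bNS _) (conn1 eE).
by have := Es_irr eE; rewrite (NS_disj h h') eqxx.
Qed.

Let C_NC e x : e \in Es -> x \in C e -> (x \in NM e) && (x \notin B0 e.2).
Proof. by move=> eE; rewrite inE => /(rook_in_mem (x0NC eE)); rewrite inE andbC. Qed.

Let B_cases p x : x \in B p ->
  x \in B0 p \/ exists e, [/\ e \in Es, e.1 = p & x \in C e].
Proof.
rewrite inE => /orP[|/bigcupP[e /andP[eE /eqP ep] xC]]; first by left.
by right; exists e.
Qed.

Let B0C p e x : e \in Es -> x \in B0 p -> x \in C e -> p = e.1.
Proof.
move=> eE xB xC; have /andP[xM xnB] := C_NC eE xC.
have [//|p2] := NS_NM eE (B0_NS xB) xM.
by rewrite -p2 xB in xnB.
Qed.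

(** The walk in [NM e] from [x0 e] to [y0 e] ends in [B0 e.2]. If no pixel of [C e] touched
    [B0 e.2], the walk could never leave [C e], which avoids [B0 e.2]. *)
Lemma touching_pixels e : e \in Es ->
  exists xy : P * P, [/\ xy.1 \in C e, xy.2 \in B0 e.2 & rook xy.1 xy.2].
Proof.
move=> eE; apply: contrapT => no.
suff cl x : connect (rook_in (NM e)) (x0 e) x -> x \in C e.
  have /andP[_] := C_NC eE (cl _ (connM eE)).
  by rewrite inE conn2.
case/connectP=> p; elim/last_ind: p x => [|p y IHp] x.
  by move=> _ ->; rewrite inE connect0.
rewrite rcons_path last_rcons => /andP[/IHp/(_ erefl) pC /and3P[ry _ yM]] ->.
have yNB : y \notin B0 e.2 by apply/negP => yB; apply: no; exists (last (x0 e) p, y).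
have /andP[pM pNB] := C_NC eE pC.
move: pC; rewrite !inE => /connect_trans; apply; apply: connect1.
by rewrite /rook_in /= ry !inE pM yM; move: yNB pNB; rewrite !inE => -> ->.
Qed.

Lemma regions_minor : exists (B : V -> {set P}) (ex ey : V * V -> P),
  [/\ forall p x, x \in B p -> interior x,
      forall p q x, x \in B p -> x \in B q -> p = q,
      forall p x, x \in B p -> connect (rook_in (B p)) (b p) x &
      forall e, e \in Es -> [/\ ex e \in B e.1, ey e \in B e.2 & rook (ex e) (ey e)]].
Proof.
(* The default for pairs that are not edges is arbitrary. *)
have /choice[xy xyP] : forall e, exists xy : P * P, e \in Es ->
    [/\ xy.1 \in C e, xy.2 \in B0 e.2 & rook xy.1 xy.2].
  move=> e; have [/touching_pixels[xy ?]|_] := boolP (e \in Es); first by exists xy.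
  by exists (b e.1, b e.1).
exists B, (fun e => (xy e).1), (fun e => (xy e).2); split.
- move=> p x /B_cases[/B0_NS/NS_int //|[e [eE _ /(C_NC eE)/andP[/NM_int]]]].
  by move/(_ eE).
- move=> p q x /B_cases[xp|[e [eE <- xe]]] /B_cases[xq|[e' [e'E <- xe']]].
  + exact: NS_disj (B0_NS xp) (B0_NS xq).
  + exact: B0C xe'.
  + exact/esym/(B0C _ _ xe).
  + have /andP[h _] := C_NC eE xe; have /andP[h' _] := C_NC e'E xe'.
    by rewrite (NM_disj eE e'E h h').
- have B0B p x : x \in B0 p -> x \in B p by move=> h; rewrite inE h.
  have cB0 p x : x \in B0 p -> connect (rook_in (B p)) (b p) x.
    rewrite inE => h; apply: (rook_in_sub _ h) => y hy; apply: B0B.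
    by rewrite inE.
  move=> p x /B_cases[/cB0 //|[e [eE ep xC]]].
  rewrite -ep; apply: (connect_trans (cB0 _ (x0 e) _)).
    by rewrite inE conn1.
  move: xC; rewrite inE => h; apply: (rook_in_sub _ h) => y hy.
  rewrite inE; apply/orP; right; apply/bigcupP; exists e; first by rewrite eE eqxx.
  by rewrite inE.
- move=> e eE; have [h1 h2 h3] := xyP e eE; split=> //.
    by rewrite inE; apply/orP; right; apply/bigcupP; exists e; rewrite ?eE ?eqxx.
  by rewrite inE h2.
Qed.

End Regions.

(** * Compactness, and approximation of plane sets by cells *)

Section Topology.
Local Open Scope classical_set_scope.
Local Open Scope ring_scope.
Variable R : realType.

(** The set of differences is compact, hence closed, and does not contain 0, so it misses a ball
    around 0. *)
Lemma compact_separated (K L : set (R * R)) : compact K -> compact L ->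
  (forall x, K x -> L x -> False) ->
  exists2 eps : R, 0 < eps & forall x y, K x -> L y -> eps <= `|x - y|.
Proof.
move=> cK cL KL.
pose sub (z : (R * R) * (R * R)) : R * R := z.1 - z.2.
have cD : compact (sub @` (K `*` L)).
  apply: continuous_compact; last exact: compact_setX.
  by apply: continuous_subspaceT; exact: sub_continuous.
have oD : open (~` (sub @` (K `*` L))).
  by rewrite openC; apply: compact_closed => //; exact: norm_hausdorff.
have n0 : (~` (sub @` (K `*` L))) 0.
  by move=> [[x y] [/= Kx Ly] /subr0_eq /= xy]; apply: (KL x) => //; rewrite xy.
have /nbhs_ballP[eps /= e0 sube] := open_nbhs_nbhs (conj oD n0).
exists eps => // x y Kx Ly; rewrite leNgt; apply/negP => lt.
apply: (sube (x - y)); last by exists (x, y).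
by rewrite -ball_normE /= sub0r normrN.
Qed.

Lemma uniform_continuity (f : R -> R * R) : {within `[0, 1], continuous f} ->
  forall eps, 0 < eps -> exists2 delta, 0 < delta &
    forall s t, 0 <= s <= 1 -> 0 <= t <= 1 -> `|s - t| < delta -> `|f s - f t| < eps.
Proof.
move=> /subspace_continuousP fc eps e0.
have e20 : 0 < eps / 2 by rewrite divr_gt0.
pose Q (d s : R) :=
  forall t, 0 <= t <= 1 -> `|s - t| < d -> `|f s - f t| < eps.
(* Compactness of the segment in its near-covering form turns the local moduli into one [d] good for
   all points. *)
have cov : near_covering_within `[(0:R), 1].
  by apply/near_covering_withinP/compact_near_coveringP; exact: segment_compact.
have : \forall d \near (0:R)^'+, `[0, 1] `<=` Q d.
  apply: cov => x x01.
  have /cvgrPdist_lt/(_ _ e20) := fc x x01.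
  move=> /nbhs_ballP[d /= d0 dP].
  have d20 : 0 < d / 2 by rewrite divr_gt0.
  have dP' s : `|x - s| < d -> 0 <= s <= 1 -> `|f x - f s| < eps / 2.
    by move=> xs s01; apply: dP; rewrite /= ?in_itv // -ball_normE.
  near=> s d' => /= s01 t t01 st.
  have -> : f s - f t = (f x - f t) - (f x - f s).
    by rewrite opprB [RHS]addrC addrA subrK.
  have xs : `|x - s| < d / 2.
    by near: s; apply/nbhs_ballP; exists (d / 2) => // s; rewrite -ball_normE.
  have d'd : d' <= d / 2 by near: d'; exact: nbhs_right_le.
  apply: (le_lt_trans (ler_normB _ _)); rewrite [ltRHS]splitr; apply: ltrD.
    apply: dP' => //; rewrite -[x - t](subrKA s) [ltRHS]splitr.
    by apply: (le_lt_trans (ler_normD _ _)); apply: ltrD => //; exact: lt_le_trans d'd.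
  apply: dP'; last by move: s01; rewrite in_itv.
  by apply: (lt_trans xs); rewrite ltr_pdivrMr // ltr_pMr // ltr1n.
move=> near_d; near (0:R)^'+ => d.
exists d; first by near: d; exact: nbhs_right_gt.
have dQ : `[0, 1] `<=` Q d by near: d.
by move=> s t s01; apply: dQ; rewrite /= in_itv.
Unshelve. all: by end_near. Qed.

Variables (kappa c : R).
Hypothesis kappa0 : 0 < kappa.

(* The plane is cut into square cells of side 1 / kappa; the square of centre 0
   and half side c is covered by cells which are away from the border of the
   grid. *)
Definition grid_size : nat := (Num.truncn (kappa * (c + c))).+4.
Definition cell_coord (a : R) : nat := (Num.truncn (kappa * (a + c))).+2.
Definition cell (x : R * R) : 'I_grid_size.+1 * 'I_grid_size.+1 :=
  px grid_size (cell_coord x.1) (cell_coord x.2).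

(** The margin of two cells keeps the neighbours of these cells, added in [near_cells], in the
    interior. *)
Lemma cell_coord_bound a : `|a| <= c -> (2 <= cell_coord a <= grid_size - 2)%N.
Proof.
rewrite ler_norml => /andP[ca ac]; rewrite /cell_coord /grid_size /=.
have : (Num.truncn (kappa * (a + c)) <= Num.truncn (kappa * (c + c)))%N; last first.
  by move: (Num.truncn _) (Num.truncn _) => t T; lia.
by apply: le_truncn; rewrite ler_pM2l // lerD2r.
Qed.

Lemma cell_coord_near a a' : `|a| <= c -> `|a'| <= c -> kappa * `|a - a'| < 1 ->
  (cell_coord a <= (cell_coord a').+1)%N.
Proof.
rewrite !ler_norml => /andP[ca ac] /andP[ca' ac'] aa'.
have h : kappa * (a + c) < kappa * (a' + c) + 1.
  have : kappa * (a - a') < 1 by apply: le_lt_trans aa'; rewrite ler_pM2l // ler_norm.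
  by rewrite mulrBr !mulrDr; lra.
have h1 : 0 <= kappa * (a + c) by rewrite mulr_ge0 ?(ltW kappa0) //; lra.
have h2 : 0 <= kappa * (a' + c) by rewrite mulr_ge0 ?(ltW kappa0) //; lra.
have /andP[t1 t2] := truncn_itv h1; have /andP[t3 t4] := truncn_itv h2.
rewrite /cell_coord !ltnS -ltnS -(ltr_nat R) -!natr1.
move: t4; rewrite -natr1; lra.
Qed.

(** Two is the largest difference between coordinates of cells that have a common neighbour; whence
    the constant 3 in the separation of regions. *)
Lemma cell_coord_far a a' : `|a| <= c -> `|a'| <= c ->
  (cell_coord a <= (cell_coord a').+2)%N -> kappa * (a - a') < 3.
Proof.
rewrite !ler_norml => /andP[ca ac] /andP[ca' ac'] aa'.
have h1 : 0 <= kappa * (a + c) by rewrite mulr_ge0 ?(ltW kappa0) //; lra.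
have h2 : 0 <= kappa * (a' + c) by rewrite mulr_ge0 ?(ltW kappa0) //; lra.
have /andP[t1 t2] := truncn_itv h1; have /andP[t3 t4] := truncn_itv h2.
move: aa' t1 t2 t3 t4; rewrite /cell_coord.
move: (Num.truncn (kappa * (a + c))) (Num.truncn (kappa * (a' + c))) => T T'.
rewrite !ltnS -(ler_nat R) -addn2 natrD -!natr1 mulrBr !mulrDr => *; lra.
Qed.


Definition king (x y : 'I_grid_size.+1 * 'I_grid_size.+1) : bool :=
  (x.1 <= y.1.+1 <= x.1.+2)%N && (x.2 <= y.2.+1 <= x.2.+2)%N.

(** The cells of [A] are thickened by one king move so that a diagonal step between two of them can
    be replaced by two rook moves. *)
Definition near_cells (A : set (R * R)) : {set 'I_grid_size.+1 * 'I_grid_size.+1} :=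
  [set x | `[< exists2 a, A a & king x (cell a) >]]%SET.

Lemma norm_fst (a : R * R) : `|a.1| <= `|a|.
Proof. by rewrite [leRHS]prod_normE le_max lexx. Qed.

Lemma norm_snd (a : R * R) : `|a.2| <= `|a|.
Proof. by rewrite [leRHS]prod_normE le_max lexx orbT. Qed.

Lemma cell_val a : `|a| <= c ->
  (((cell a).1 = cell_coord a.1 :> nat) * ((cell a).2 = cell_coord a.2 :> nat))%type.
Proof.
move=> ac; have h1 := cell_coord_bound (le_trans (norm_fst a) ac).
have h2 := cell_coord_bound (le_trans (norm_snd a) ac).
by rewrite /cell /px /= !inordK; [split | lia | lia].
Qed.

Lemma mem_near_cells (A : set (R * R)) a : A a -> cell a \in near_cells A.
Proof. by move=> Aa; rewrite inE; apply/asboolP; exists a => //; rewrite /king; lia. Qed.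

Section Region.
Variable A : set (R * R).
Hypothesis A_bounded : forall a, A a -> `|a| <= c.

Lemma near_cells_interior x : x \in near_cells A -> interior x.
Proof.
rewrite inE => /asboolP[a /A_bounded ac].
have h1 := cell_coord_bound (le_trans (norm_fst a) ac).
have h2 := cell_coord_bound (le_trans (norm_snd a) ac).
rewrite /king /interior !(cell_val ac).
move: h1 h2; move: (x.1 : nat) (x.2 : nat) (cell_coord _) (cell_coord _) => i j k l.
move: grid_size => g; lia.
Qed.

Lemma near_cells_disjoint (B : set (R * R)) x :
  (forall a, B a -> `|a| <= c) -> x \in near_cells A -> x \in near_cells B ->
  exists a b, [/\ A a, B b & kappa * `|a - b| < 3].
Proof.
move=> B_bounded; rewrite inE => /asboolP[a Aa xa].
rewrite inE => /asboolP[b Bb xb].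
exists a, b; split=> //.
have ac := A_bounded Aa; have bc := B_bounded _ Bb.
have a1 := le_trans (norm_fst a) ac; have a2 := le_trans (norm_snd a) ac.
have b1 := le_trans (norm_fst b) bc; have b2 := le_trans (norm_snd b) bc.
move: xa xb; rewrite /king !(cell_val ac) !(cell_val bc) => xa xb.
have far u v : `|u| <= c -> `|v| <= c -> (cell_coord u <= (cell_coord v).+2)%N ->
    (cell_coord v <= (cell_coord u).+2)%N -> kappa * `|u - v| < 3.
  move=> uc vc uv vu; have := cell_coord_far uc vc uv; have := cell_coord_far vc uc vu.
  by case: (lerP 0 (u - v)) => h; [rewrite ger0_norm | rewrite ltr0_norm // opprB].
rewrite prod_normE maxr_pMr ?(ltW kappa0) // gt_max.
have close (i k l : nat) : (i <= k.+1 <= i.+2)%N -> (i <= l.+1 <= i.+2)%N -> (k <= l.+2)%N.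
  by lia.
case/andP: xa => xa1 xa2; case/andP: xb => xb1 xb2.
apply/andP; split; apply: far => //.
- exact: close xa1 xb1.
- exact: close xb1 xa1.
- exact: close xa2 xb2.
- exact: close xb2 xa2.
Qed.

Lemma near_cells_step a a' : A a -> A a' -> kappa * `|a - a'| < 1 ->
  connect (rook_in (near_cells A)) (cell a) (cell a').
Proof.
move=> Aa Aa' aa'.
have ac := A_bounded Aa; have ac' := A_bounded Aa'.
have a1 := le_trans (norm_fst a) ac; have a2 := le_trans (norm_snd a) ac.
have b1 := le_trans (norm_fst a') ac'; have b2 := le_trans (norm_snd a') ac'.
have aa1 : kappa * `|a.1 - a'.1| < 1.
  by apply: le_lt_trans aa'; rewrite ler_pM2l // (norm_fst (a - a')).
have aa2 : kappa * `|a.2 - a'.2| < 1.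
  by apply: le_lt_trans aa'; rewrite ler_pM2l // (norm_snd (a - a')).
have n1 := cell_coord_near a1 b1 aa1; have n2 := cell_coord_near a2 b2 aa2.
rewrite distrC in aa1; have n3 := cell_coord_near b1 a1 aa1.
rewrite distrC in aa2; have n4 := cell_coord_near b2 a2 aa2.
have ci := cell_val ac; have ci' := cell_val ac'.
move: (cell_coord a.1) (cell_coord a.2) (cell_coord a'.1) (cell_coord a'.2) n1 n2 n3 n4 ci ci'.
move=> i j i' j' n1 n2 n3 n4 ci ci'.
(* [x] is the corner cell of the possibly diagonal step; either half of the detour may be
   trivial. *)
pose x := ((cell a').1, (cell a).2).
have xA : x \in near_cells A.
  rewrite inE; apply/asboolP; exists a => //.
  by rewrite /king /= !ci !ci'; lia.
have step y z : y \in near_cells A -> z \in near_cells A ->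
    rook y z \/ y = z -> connect (rook_in (near_cells A)) y z.
  move=> yA zA [ryz|->]; last exact: connect0.
  by apply: connect1; rewrite /rook_in /= ryz yA.
apply: (connect_trans (step _ x (mem_near_cells Aa) xA _)).
  have [e|ne] := eqVneq i i'.
    right; rewrite /x [LHS]surjective_pairing; congr (_, _).
    by apply/val_inj; rewrite /= !ci !ci'.
  by left; rewrite /rook /= eqxx /= !ci !ci'; lia.
apply: step (mem_near_cells Aa') _ => //.
have [e|ne] := eqVneq j j'.
  right; rewrite /x [RHS]surjective_pairing; congr (_, _).
  by apply/val_inj; rewrite /= !ci !ci'.
by left; rewrite /rook /= eqxx /= !ci !ci'; lia.
Qed.

Lemma near_cells_connect (f : R -> R * R) (s t : R) :
  {within `[0, 1], continuous f} -> 0 <= s -> s <= t -> t <= 1 ->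
  (forall u, s <= u <= t -> A (f u)) ->
  connect (rook_in (near_cells A)) (cell (f s)) (cell (f t)).
Proof.
move=> fc s0 st t1 fA.
have ki0 : 0 < kappa^-1 by rewrite invr_gt0.
have [d d0 dP] := uniform_continuity fc (eps := kappa^-1) ki0.
(* With [N] equal steps from [s] to [t], each of length at most 1 / N < d, consecutive images are
   less than one cell side apart. *)
pose N := (Num.truncn (d^-1)).+1.
have N0 : 0 < N%:R :> R by rewrite ltr0n.
have Nd : N%:R^-1 < d.
  by rewrite -[ltRHS]invrK ltf_pV2 ?posrE ?invr_gt0 // truncnS_gt.
pose u k : R := s + (t - s) * (k%:R / N%:R).
have uP k : (k <= N)%N -> s <= u k <= t.
  move=> kN; have k0 : 0 <= k%:R / N%:R :> R by rewrite divr_ge0.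
  have k1 : k%:R / N%:R <= 1 :> R by rewrite ler_pdivrMr // mul1r ler_nat.
  rewrite /u; apply/andP; split; first by rewrite lerDl mulr_ge0 // subr_ge0.
  by rewrite -lerBrDl ler_piMr // subr_ge0.
suff H k : (k <= N)%N -> connect (rook_in (near_cells A)) (cell (f s)) (cell (f (u k))).
  by have := H N (leqnn _); rewrite /u divff ?gt_eqF // mulr1 addrC subrK.
elim: k => [_|k IHk kN]; first by rewrite /u mul0r mulr0 addr0.
apply: connect_trans (IHk (ltnW kN)) _.
have /andP[uk1 uk2] := uP k (ltnW kN); have /andP[uk3 uk4] := uP k.+1 kN.
apply: near_cells_step; [apply: fA; exact: uP (ltnW kN)|apply: fA; exact: uP|].
rewrite -ltr_pdivlMl // mulr1; apply: dP; [lra|lra|].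
have -> : u k - u k.+1 = - ((t - s) * N%:R^-1) by rewrite /u -natr1; ring.
rewrite normrN ger0_norm ?mulr_ge0 ?subr_ge0 ?invr_ge0 //.
by apply: le_lt_trans Nd; rewrite ler_piMl ?invr_ge0 //; lra.
Qed.

End Region.
End Topology.

(** * The dual of a plane drawing *)

Section PlanarDual.
Local Open Scope classical_set_scope.
Local Open Scope ring_scope.
Variables (R : realType) (G : sgraph).

Lemma within_image_compact (f : R -> R * R) (a b : R) :
  {within `[0, 1], continuous f} -> 0 <= a -> b <= 1 -> compact (f @` `[a, b]).
Proof.
move=> fc a0 b1; apply: continuous_compact; last exact: segment_compact.
apply: continuous_subspaceW fc => x /=; rewrite !in_itv /= => /andP[ax xb].
by rewrite (le_trans a0 ax) (le_trans xb b1).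
Qed.

Lemma finite_union_compact (T : topologicalType) (I : choiceType) (s : seq I) (F : I -> set T) :
  (forall i, i \in s -> compact (F i)) -> compact [set x | exists2 i, i \in s & F i x].
Proof.
move=> Fc; have -> : [set x | exists2 i, i \in s & F i x] = \big[setU/set0]_(i <- s | i \in s) F i.
  rewrite -big_seq -bigcup_seq; apply/seteqP.
  by split=> x [i si Fi]; exists i.
exact: bigsetU_compact.
Qed.

Lemma planar_has_dual : planar R G -> has_dual (@adj G).
Proof.
case=> pt [arc [pt_inj arc_sym arcP arc_pt arc_cross]].
set Es := oriented (@adj G).
have Es_adj e : e \in Es -> adj e.1 e.2 by rewrite inE => /andP[].
have Es_irr e : e \in Es -> e.1 != e.2.
  by move=> /Es_adj h; apply/eqP => h'; rewrite h' adj_irrefl in h.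
have Es_asym e : e \in Es -> (e.2, e.1) \notin Es.
  rewrite !inE /= => /andP[_ lt]; apply/negP => /andP[_ gt]; lia.
have Es_inj e e' : e \in Es -> e' \in Es -> [set e.1; e.2]%SET = [set e'.1; e'.2]%SET -> e = e'.
  move=> eE e'E E; have := set21 e.1 e.2; have := set22 e.1 e.2; rewrite E !inE.
  case: e e' {E} eE e'E => [a b] [a' b'] /= eE e'E.
  case/orP=> /eqP h2 /orP[] /eqP h1; move: (Es_irr _ eE) => /=; rewrite ?h1 ?h2 ?eqxx //.
  by have := Es_asym _ e'E; rewrite /= -h1 -h2 eE.
(* One parametrization is fixed per oriented edge, with a constant as default elsewhere. *)
have /choice[h hP] : forall e : G * G, exists h : R -> R * R, e \in Es ->
    [/\ {within `[0, 1], continuous h}, {in `[0, 1] &, injective h},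
        h @` `[0, 1] = arc e.1 e.2, h 0 = pt e.1 & h 1 = pt e.2].
  move=> e; have [/Es_adj/arcP[h hP]|_] := boolP (e \in Es); first by exists h.
  by exists (fun _ => 0).
have in01 (t : R) : 0 <= t <= 1 -> t \in `[0, 1] by rewrite in_itv.
have h_arc e (t : R) : e \in Es -> 0 <= t <= 1 -> arc e.1 e.2 (h e t).
  by move=> /hP[_ _ <- _ _] t01; exists t => //=; rewrite in_itv.
have h_pt e (t : R) w : e \in Es -> 0 <= t <= 1 -> h e t = pt w ->
    (w = e.1 /\ t = 0) \/ (w = e.2 /\ t = 1).
  move=> eE t01 E; have [_ hinj _ h0 h1] := hP e eE.
  have := h_arc e t eE t01; rewrite E => /(arc_pt _ _ _ (Es_adj _ eE))[] ?; subst w; [left|right].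
    by split=> //; apply: hinj; rewrite ?in01 ?lexx ?ler01 // h0.
  by split=> //; apply: hinj; rewrite ?in01 ?lexx ?ler01 // h1.
have h_cross e e' (s t : R) : e \in Es -> e' \in Es -> 0 <= s <= 1 -> 0 <= t <= 1 ->
    h e s = h e' t -> (e = e' /\ s = t) \/ exists w, h e s = pt w.
  move=> eE e'E s01 t01 E; have [ee|ne] := eqVneq e e'.
    left; split=> //; subst e'; have [_ hinj _ _ _] := hP e eE.
    by apply: hinj; rewrite ?in01.
  right; have neq : [set e.1; e.2]%SET != [set e'.1; e'.2]%SET.
    by apply: contra_neq ne; exact: Es_inj.
  have both : (arc e.1 e.2 `&` arc e'.1 e'.2) (h e s).
    by split; [exact: h_arc | rewrite E; exact: h_arc].
  have [w _ wE] := arc_cross _ _ _ _ (Es_adj _ eE) (Es_adj _ e'E) neq _ both.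
  by exists w.
(* An edge is parametrized from [e.1] to [e.2], so its piece at [p] is the first third if it starts
   at [p] and the last third if it ends there; the point of [p] is added for isolated vertices. *)
pose S p : set (R * R) := [set pt p] `|`
  ([set x | exists2 e, e \in [seq e <- enum Es | e.1 == p] & (h e @` `[0, 3^-1]) x] `|`
   [set x | exists2 e, e \in [seq e <- enum Es | e.2 == p] & (h e @` `[2 / 3, 1]) x]).
pose M e : set (R * R) := h e @` `[3^-1, 2 / 3].
have SP p x : S p x -> x = pt p \/ exists (e : G * G) (t : R), [/\ e \in Es, 0 <= t <= 1, x = h e t
    & (e.1 = p /\ t <= 3^-1) \/ (e.2 = p /\ 2 / 3 <= t)].
  case=> [->|[[e]|[e]]]; first by left.
  - rewrite mem_filter mem_enum => /andP[/eqP ep eE] [t /=]; rewrite in_itv /= => /andP[t0 t1] <-.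
    by right; exists e, t; split; [ | lra | | left].
  - rewrite mem_filter mem_enum => /andP[/eqP ep eE] [t /=]; rewrite in_itv /= => /andP[t0 t1] <-.
    by right; exists e, t; split; [ | lra | | right].
have MP e x : M e x -> exists2 t, 3^-1 <= t <= 2 / 3 & x = h e t.
  by case=> t /=; rewrite in_itv /= => ? <-; exists t.
have S1 e (t : R) : e \in Es -> 0 <= t <= 3^-1 -> S e.1 (h e t).
  move=> eE t01; right; left; exists e; first by rewrite mem_filter mem_enum eE eqxx.
  by exists t => //=; rewrite in_itv.
have S2 e (t : R) : e \in Es -> 2 / 3 <= t <= 1 -> S e.2 (h e t).
  move=> eE t01; right; right; exists e; first by rewrite mem_filter mem_enum eE eqxx.
  by exists t => //=; rewrite in_itv.
have Sc p : compact (S p).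
  apply: compactU; first exact: compact_set1.
  by apply: compactU; apply: finite_union_compact => e; rewrite mem_filter mem_enum
    => /andP[_ /hP[hc _ _ _ _]]; apply: within_image_compact => //; lra.
have Mc e : e \in Es -> compact (M e).
  by move=> /hP[hc _ _ _ _]; apply: within_image_compact => //; lra.
have S_vertex p e (t : R) w : e \in Es -> 0 <= t <= 1 ->
    (e.1 = p /\ t <= 3^-1) \/ (e.2 = p /\ 2 / 3 <= t) -> h e t = pt w -> w = p.
  by move=> eE t01 own /(h_pt _ _ _ eE t01)[] [-> tE]; case: own => -[h1 h2] //; exfalso; lra.
have S_disj p q x : S p x -> S q x -> p = q.
  move=> /SP[->|[e [s [eE s01 -> own]]]] /SP[|[e' [t [e'E t01 E own']]]].
  - exact: pt_inj.
  - exact: S_vertex own' (esym E).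
  - by move/(S_vertex _ _ _ _ eE s01 own).
  - have [[? ?]|[w wE]] := h_cross _ _ _ _ eE e'E s01 t01 E.
      by subst e' t; case: own own' => -[h1 h2] [] [h3 h4]; rewrite -?h1 -?h3 //; exfalso; lra.
    have wE' := etrans (esym E) wE.
    by rewrite -(S_vertex _ _ _ _ eE s01 own wE) (S_vertex _ _ _ _ e'E t01 own' wE').
have mid01 (t : R) : 3^-1 <= t <= 2 / 3 -> 0 <= t <= 1 by move=> ?; lra.
have mid_pt e (t : R) w : e \in Es -> 3^-1 <= t <= 2 / 3 -> h e t <> pt w.
  by move=> eE tm /(h_pt _ _ _ eE (mid01 t tm))[] [_ tE]; lra.
have M_disj e e' x : e \in Es -> e' \in Es -> M e x -> M e' x -> e = e'.
  move=> eE e'E /MP[s sm ->] /MP[t tm E].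
  have [[]//|[w]] := h_cross _ _ _ _ eE e'E (mid01 _ sm) (mid01 _ tm) E.
  by move/mid_pt; case.
have SM_disj p e x : e \in Es -> S p x -> M e x -> p = e.1 \/ p = e.2.
  move=> eE /SP[->|[e' [s [e'E s01 -> own]]]] /MP[t tm E].
    by have := mid_pt _ _ _ eE tm (esym E).
  have [[? ?]|[w]] := h_cross _ _ _ _ e'E eE s01 (mid01 _ tm) E.
    by subst e' t; case: own => -[<- _]; [left|right].
  by rewrite E => /mid_pt; case.
(* Stars and middle thirds are indexed by one finite type, to treat all pairs of them at once. *)
pose K (i : G + G * G) : set (R * R) := match i with inl p => S p | inr e => M e end.
pose ok (i : G + G * G) := match i with inl p => true | inr e => e \in Es end.
have Kc i : ok i -> compact (K i) by case: i => [p _|e]; [exact: Sc | exact: Mc].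
(* There are finitely many pairs, so one [eps] separates all the disjoint ones. *)
have [eps eps0 epsP] : exists2 eps : R, 0 < eps & forall i j x y, ok i -> ok j ->
    (forall z, K i z -> K j z -> False) -> K i x -> K j y -> eps <= `|x - y|.
  have H : \forall d \near (0:R)^'+, forall ij : (G + G * G) * (G + G * G),
      ok ij.1 -> ok ij.2 -> (forall z, K ij.1 z -> K ij.2 z -> False) ->
      forall x y, K ij.1 x -> K ij.2 y -> d <= `|x - y|.
    apply: filter_forall => -[i j] /=.
    have [oi|] := boolP (ok i); last by move=> _; apply: nearW.
    have [oj|] := boolP (ok j); last by move=> _; apply: nearW.
    have [dij|nd] := pselect (forall z, K i z -> K j z -> False); last by apply: nearW.
    have [e e0 eP] := compact_separated (Kc i oi) (Kc j oj) dij.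
    near=> d => _ _ _ x y Kx Ky; apply: le_trans (eP x y Kx Ky).
    by near: d; exact: nbhs_right_le.
  near (0:R)^'+ => d.
  exists d; first by near: d; exact: nbhs_right_gt.
  have Hd : forall ij : (G + G * G) * (G + G * G),
      ok ij.1 -> ok ij.2 -> (forall z, K ij.1 z -> K ij.2 z -> False) ->
      forall x y, K ij.1 x -> K ij.2 y -> d <= `|x - y| by near: d.
  by move=> i j x y oi oj dij; exact: (Hd (i, j)).
have [c cP] : exists c : R, forall i x, ok i -> K i x -> `|x| <= c.
  have H : \forall c \near +oo, forall i x, ok i -> K i x -> `|x| <= c.
    apply: filter_forall => i; have [oi|] := boolP (ok i); last by move=> _; apply: nearW.
    have [c [cR cb]] := compact_bounded (Kc i oi).
    exists c; split=> // d cd x _ Kx; exact: cb cd x Kx.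
  by have [c [_ cP]] := H; exists (c + 1); apply: cP; rewrite ltrDl.
(* The cell side is eps / 3: a cell near two regions gives points of them at distance less than
   three sides, that is less than [eps], so the regions meet. *)
pose kappa := 3 / eps.
have kappa0 : 0 < kappa by rewrite divr_gt0.
pose NC (A : set (R * R)) := near_cells kappa c A.
have NC_disj i j x : ok i -> ok j -> x \in NC (K i) -> x \in NC (K j) ->
    exists z, K i z /\ K j z.
  move=> oi oj xi xj; apply: contrapT => no.
  have [a [b [Ka Kb ab]]] :=
    near_cells_disjoint kappa0 (fun a => cP i a oi) (fun b => cP j b oj) xi xj.
  have := epsP i j a b oi oj (fun z zi zj => no (ex_intro _ z (conj zi zj))) Ka Kb.
  move: ab; rewrite /kappa mulrAC ltr_pdivrMr // ltr_pM2l // => h1 h2.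
  by have := lt_le_trans h1 h2; rewrite ltxx.
pose b p := cell kappa c (pt p).
pose x0 e := cell kappa c (h e 3^-1).
pose y0 e := cell kappa c (h e (2 / 3)).
have Sbd p a : S p a -> `|a| <= c by exact: (cP (inl p)).
have Mbd e a : e \in Es -> M e a -> `|a| <= c by move=> eE; exact: (cP (inr e)).
have connp A (f : R -> R * R) s t : (forall a, A a -> `|a| <= c) ->
    {within `[0, 1], continuous f} -> 0 <= s -> s <= t -> t <= 1 ->
    (forall u, s <= u <= t -> A (f u)) ->
    connect (rook_in (NC A)) (cell kappa c (f s)) (cell kappa c (f t)).
  by move=> Ab; exact: (near_cells_connect kappa0 Ab).
have [||||||||||B [ex [ey [Bint Bdisj Bconn exy]]]] := @regions_minor _ _ Es
  (fun p => NC (S p)) (fun e => NC (M e)) b x0 y0 Es_irr.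
- move=> p x; exact: (near_cells_interior kappa0 (Sbd p)).
- move=> e x eE; exact: (near_cells_interior kappa0 (fun a => Mbd e a eE)).
- move=> p q x xp xq; have [z [zp zq]] := NC_disj (inl p) (inl q) x isT isT xp xq.
  exact: S_disj zp zq.
- move=> e e' x eE e'E xe xe'.
  have [z [ze ze']] := NC_disj (inr e) (inr e') x eE e'E xe xe'.
  exact: M_disj ze ze'.
- move=> p e x eE xp xe; have [z [zp ze]] := NC_disj (inl p) (inr e) x isT eE xp xe.
  exact: SM_disj zp ze.
- by move=> p; apply: (mem_near_cells c kappa0); left.
- move=> e eE; have [hc _ _ h0 _] := hP e eE; rewrite /b -h0.
  by apply: connp; [exact: Sbd | exact: hc | lra | lra | lra | move=> u ?; exact: S1].
- move=> e eE; have [hc _ _ _ h1] := hP e eE; rewrite /b -h1.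
  (* The last third is parametrized towards the vertex, so the connection is reversed. *)
  rewrite (sym_connect_sym _); last first.
    by move=> u v; rewrite /rook_in /= rook_sym andbA andbAC -andbA.
  by apply: connp; [exact: Sbd | exact: hc | lra | lra | lra | move=> u ?; exact: S2].
- move=> e eE; have [hc _ _ _ _] := hP e eE.
  apply: connp; [by move=> a; exact: Mbd | exact: hc | lra | lra | lra |].
  by move=> u ?; exists u => //=; rewrite in_itv.
- move=> e eE; apply: (mem_near_cells c kappa0).
  by exists 3^-1 => //=; rewrite in_itv /=; apply/andP; split; lra.
have exB e : e \in Es -> ex e \in B e.1 by case/exy.
have eyB e : e \in Es -> ey e \in B e.2 by case/exy.
have exey e : e \in Es -> rook (ex e) (ey e) by case/exy.
exists _, (faceL Es B ex ey), (faceR Es B ex ey); split.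
  exact: (cycle_is_face_boundary Es_irr Es_asym Bint Bdisj Bconn exB eyB exey).
exact: (face_boundary_closed Es_irr Es_asym Bint Bdisj exB eyB exey).
Unshelve. all: by end_near. Qed.

End PlanarDual.

(** * Discharging *)

Section Discharging.
Variables (V : finType) (e : rel V) (D : nat) (K : {set V}).
Hypothesis e_sym : symmetric e.
Hypothesis e_irr : irreflexive e.

Definition nbrs (v : V) : {set V} := [set u : V | e v u].
Definition deg (v : V) : nat := #|nbrs v|.
Definition degK (v : V) : nat := #|nbrs v :&: K|.

Hypothesis deg_max : forall v, deg v <= D.
Hypothesis outK : forall a b, e a b -> a \notin K ->
  b \in K /\ exists2 x, x != b & e a x.

(* [share w] bounds the number of vertices of K that a neighbour of w in K sees
   at distance at most 2 through w, w included. *)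
Definition share (w : V) : nat := degK w - (w \notin K).

Hypothesis share_sum : forall v, v \in K -> D + 7 <= \sum_(u in nbrs v) share u.

Definition light2 (v : V) : bool := (v \notin K) && (deg v == 2).
Definition light3 (v : V) : bool := (v \notin K) && (deg v == 3).
(** Seven serves twice: a hub collects 7 * 6 >= 40 from its neighbours in [K], and the neighbours of
    a vertex of [K] of degree 2 have share at least (D + 7) - D = 7. *)
Definition hub (v : V) : bool := 7 <= degK v.
Definition nbrs2 (v : V) : {set V} := [set u in nbrs v | light2 u].
Definition nbrs3 (v : V) : {set V} := [set u in nbrs v | light3 u].
Definition heavy_nbrs (v : V) : {set V} :=
  [set u in nbrs v | ~~ light2 u && ~~ light3 u].

(* With all weights multiplied by 40, a vertex costs 40 and the edge uv yields
   40 - 2 * weight u v, which is split between u and v: [retained v u] is the part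
   of v, to which [demand v u], taken from the part of u, contributes.  Most edges
   have weight 8 and yield 12 to each end. *)
Definition demand (v u : V) : nat :=
  if [&& v \in K, ~~ hub v & u \in heavy_nbrs v] then
    if #|heavy_nbrs v| == 2 then 12 - 2 * deg v - 3 * #|nbrs3 v|
    else if [&& #|heavy_nbrs v| == 3, deg v == 3 & 4 <= share u] then 2 else 0
  else 0.

Definition retained (v u : V) : nat :=
  if hub v then (if light2 u then 0 else 6)
  else if light2 v then 20 else if light3 v then 14
  else if light2 u then 4 else if light3 u then 10
  else if hub u then 12 + demand v u else 12 + demand v u - demand u v.

Definition weight (u v : V) : nat := (40 - (retained u v + retained v u))./2.

Lemma in_nbrs v u : (u \in nbrs v) = e v u. Proof. by rewrite inE. Qed.

Lemma sum_nbrs (F : V -> nat) v :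
  \sum_(u in nbrs v) F u = \sum_(u in nbrs2 v) F u + \sum_(u in nbrs3 v) F u
    + \sum_(u in heavy_nbrs v) F u.
Proof.
rewrite (bigID light2) /= -addnA; congr (_ + _).
  by apply: eq_bigl => u; rewrite [RHS]inE.
rewrite (bigID light3) /=; congr (_ + _); apply: eq_bigl => u; rewrite [RHS]inE -andbA //.
congr (_ && _); rewrite /light2 /light3.
by case: (deg u =P 2) => [->|_]; rewrite ?andbF.
Qed.

Lemma deg_split v : deg v = #|nbrs2 v| + #|nbrs3 v| + #|heavy_nbrs v|.
Proof. by rewrite /deg -sum1_card sum_nbrs !sum1_card. Qed.

Lemma degK_out v : v \notin K -> degK v = deg v.
Proof.
move=> vK; rewrite /degK (finset.setIidPl _) //; apply/fintype.subsetP => u.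
by rewrite in_nbrs => /outK/(_ vK)[].
Qed.

Lemma degK_le v : degK v <= deg v.
Proof. exact/subset_leq_card/finset.subsetIl. Qed.

Lemma share_le v : share v <= D.
Proof. by rewrite /share (leq_trans (leq_subr _ _)) // (leq_trans (degK_le v)). Qed.

Lemma deg_out v u : v \notin K -> e v u -> 2 <= deg v.
Proof.
move=> vK vu; have [_ [x xu vx]] := outK vu vK.
have -> : 2 = #|[set x; u]| by rewrite cards2 xu.
by apply/subset_leq_card/fintype.subsetP => w; rewrite !inE => /orP[]/eqP->.
Qed.

Lemma nbrsK_heavy v : nbrs v :&: K \subset heavy_nbrs v.
Proof.
apply/fintype.subsetP => u; rewrite !inE => /andP[-> uK].
by rewrite /light2 /light3 uK.
Qed.

Lemma degK_heavy v : degK v <= #|heavy_nbrs v|.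
Proof. exact/subset_leq_card/nbrsK_heavy. Qed.

(** All neighbours of a light vertex lie in [K], so its share is its degree minus 1. *)
Lemma share_split v : v \in K ->
  D + 7 <= #|nbrs2 v| + 2 * #|nbrs3 v| + \sum_(u in heavy_nbrs v) share u.
Proof.
move=> /share_sum; rewrite sum_nbrs.
have -> : \sum_(u in nbrs2 v) share u = #|nbrs2 v|.
  rewrite -sum1_card; apply: eq_bigr => u; rewrite inE => /andP[_ /andP[uK /eqP d2]].
  by rewrite /share uK degK_out // d2.
have -> : \sum_(u in nbrs3 v) share u = 2 * #|nbrs3 v|.
  rewrite mulnC -sum_nat_const; apply: eq_bigr => u; rewrite inE => /andP[_ /andP[uK /eqP d3]].
  by rewrite /share uK degK_out // d3.
by [].
Qed.

Lemma sum_heavy_le v u : u \in heavy_nbrs v -> #|heavy_nbrs v| = 2 ->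
  \sum_(w in heavy_nbrs v) share w <= share u + D.
Proof.
move=> uv n2; rewrite (bigD1 u) //= leq_add2l.
have : #|heavy_nbrs v :\ u| = 1 by have := cardsD1 u (heavy_nbrs v); rewrite uv n2; lia.
move/eqP/cards1P => [u' u'E].
rewrite (eq_bigl (mem [set u'])) ?big_set1 ?share_le // => i.
by rewrite -u'E !inE andbC.
Qed.

(** If [v] has two heavy neighbours, the other one has share at most [D], so few light neighbours
    force a large share of [u]. In particular no demand reaches a vertex of share at most 3. *)
Lemma demand_le v u : demand v u <= 2 * share u - 6.
Proof.
rewrite /demand; case: ifP => // /and3P[vK _ uv].
case: eqP => [n2|_]; last by case: ifP => // /and3P[_ _]; lia.
have := share_split vK; have := sum_heavy_le uv n2.
have := deg_split v; rewrite n2; lia.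
Qed.

Lemma demand_heavy v u : 4 <= #|heavy_nbrs v| -> demand v u = 0.
Proof.
move=> n4; rewrite /demand; case: ifP => // _.
by case: eqP => [|_]; [lia | case: ifP => //; lia].
Qed.

Lemma demand_outK v u : v \notin K -> demand v u = 0.
Proof. by rewrite /demand => /negbTE->. Qed.

(** Every vertex with a neighbour pays its cost of 40. Hubs and light vertices collect fixed
    amounts; for the others the demands made on [v] are bounded by [demand_le] and its own income by
    [share_split]. *)
Lemma retained_sum v : nbrs v != finset.set0 -> 40 <= \sum_(u in nbrs v) retained v u.
Proof.
case/set0Pn => u0; rewrite in_nbrs => vu0.
have [hv|nhv] := boolP (hub v).
  apply: (@leq_trans (\sum_(u in nbrs v :&: K) 6)).
    by rewrite sum_nat_const; move: hv; rewrite /hub /degK; lia.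
  rewrite [leqRHS](bigID (mem K)) /= -[leqLHS]addn0; apply: leq_add => //.
  rewrite (eq_bigl (fun u => (u \in nbrs v) && (u \in K))) => [|u]; last by rewrite finset.in_setI.
  apply: leq_sum => u /andP[_ uK].
  by rewrite /retained hv /light2 uK.
have [l2|nl2] := boolP (light2 v).
  rewrite (eq_bigr (fun _ => 20)) => [|u _]; last by rewrite /retained (negbTE nhv) l2.
  by rewrite sum_nat_const -/(deg v); case/andP: l2 => _ /eqP->.
have [l3|nl3] := boolP (light3 v).
  rewrite (eq_bigr (fun _ => 14)) => [|u _].
    by rewrite sum_nat_const -/(deg v); case/andP: l3 => _ /eqP->.
  by rewrite /retained (negbTE nhv) (negbTE nl2) l3.
have [vK|vK] := boolP (v \in K); last first.
  have d4 : 4 <= deg v.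
    by move: nl2 nl3 (deg_out vK vu0); rewrite /light2 /light3 vK /=; lia.
  have aE := degK_out vK; have a6 : degK v <= 6 by move: nhv; rewrite /hub; lia.
  (* Here the share is [deg v - 1], so each edge retains at least 12 - (2 * (deg v - 1) - 6); the
     total for degrees 4, 5 and 6 is 48, 50 and 48. *)
  apply: (@leq_trans (\sum_(u in nbrs v) (20 - 2 * deg v))).
    rewrite sum_nat_const -/(deg v); rewrite aE in a6.
    by move: (deg v) d4 a6 => [|[|[|[|[|[|[|]]]]]]].
  apply: leq_sum => u; rewrite in_nbrs => vu; have [uK _] := outK vu vK.
  rewrite /retained (negbTE nhv) (negbTE nl2) (negbTE nl3) /light2 /light3 uK /=.
  have := demand_le u v; rewrite /share vK aE.
  by case: ifP => _; lia.
have ret u : u \in heavy_nbrs v -> 12 + demand v u - demand u v <= retained v u.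
  rewrite inE => /andP[_ /andP[/negbTE n2 /negbTE n3]].
  by rewrite /retained (negbTE nhv) (negbTE nl2) (negbTE nl3) n2 n3; case: ifP => _; lia.
rewrite sum_nbrs.
have -> : \sum_(u in nbrs2 v) retained v u = 4 * #|nbrs2 v|.
  rewrite mulnC -sum_nat_const; apply: eq_bigr => u; rewrite inE => /andP[_ u2].
  by rewrite /retained (negbTE nhv) (negbTE nl2) (negbTE nl3) u2.
have -> : \sum_(u in nbrs3 v) retained v u = 10 * #|nbrs3 v|.
  rewrite mulnC -sum_nat_const; apply: eq_bigr => u; rewrite inE => /andP[_ u3].
  have n2 : light2 u = false.
    by move: u3; rewrite /light3 /light2 => /andP[_ /eqP->]; rewrite andbF.
  by rewrite /retained (negbTE nhv) (negbTE nl2) (negbTE nl3) n2 u3.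
have dE := deg_split v; have sS := share_split vK; have aO := degK_heavy v.
have dD := deg_max v; have a6 : degK v <= 6 by move: nhv; rewrite /hub; lia.
have shv : share v = degK v by rewrite /share vK subn0.
have [a4|a3] := leqP 4 (degK v).
  have ret0 u : u \in heavy_nbrs v -> 12 - demand u v <= retained v u.
    by move/ret; rewrite (demand_heavy _ (leq_trans a4 aO)) addn0.
  (* Heavy neighbours outside [K] demand nothing; one in [K] demands at most [2 * degK v - 6]. *)
  have low : 12 * (#|heavy_nbrs v| - degK v) + degK v * (18 - 2 * degK v) <=
      \sum_(u in heavy_nbrs v) retained v u.
    rewrite (bigID (mem K)) /= addnC; apply: leq_add.
      have hKE u : (u \in heavy_nbrs v) && (u \in K) = (u \in nbrs v :&: K).
        rewrite finset.in_setI; apply/andP/andP => -[uv uK]; split=> //.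
          by move: uv; rewrite inE => /andP[].
        by apply: (fintype.subsetP (nbrsK_heavy v)); rewrite finset.in_setI uv.
      rewrite (eq_bigl _ _ hKE) -sum_nat_const.
      apply: leq_sum => u uvK; apply: leq_trans (ret0 u _); last first.
        exact: (fintype.subsetP (nbrsK_heavy v)).
      by have := demand_le u v; rewrite shv; lia.
    rewrite -(cardsID (nbrs v :&: K) (heavy_nbrs v)) (finset.setIidPr (nbrsK_heavy v)) addKn.
    rewrite mulnC -sum_nat_const (eq_bigl (fun u => (u \in heavy_nbrs v) && (u \notin K))).
      apply: leq_sum => u /andP[uv uK]; apply: leq_trans (ret0 u uv).
      by rewrite demand_outK.
    move=> u; rewrite !inE; case: (e v u) => //=.
    by rewrite andbC.
  have [n7|n6] := ltnP 6 (#|heavy_nbrs v| + #|nbrs3 v|).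
    apply: leq_trans (leq_add (leqnn _) low).
    move: (degK v) (#|heavy_nbrs v|) (#|nbrs3 v|) aO a4 a6 n7 => a o b.
    case: a => [|[|[|[|[|[|[|]]]]]]] //; lia.
  have [a5|a6'] := leqP (degK v) 5.
    apply: leq_trans (leq_trans low (leq_addl _ _)).
    apply: leq_trans (leq_addl _ _).
    by move: (degK v) a4 a5 => [|[|[|[|[|[|]]]]]].
  have n6' : #|heavy_nbrs v| = 6 by lia.
  have hK : heavy_nbrs v = nbrs v :&: K.
    by apply/esym/eqP; rewrite eqEcard nbrsK_heavy /=; rewrite -/(degK v); lia.
  (* In this case [low] gives only 6 * 6 = 36. If every heavy neighbour had share at most 2, the sum
     of shares would be at most (D - 6) + 12 < D + 7; a neighbour [u1] with three heavy neighbours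
     demands at most 2, so 10 + 5 * 6 = 40. *)
  have [u1 u1v u1a] : exists2 u, u \in heavy_nbrs v & 3 <= degK u.
    apply: contrapT => no.
    have : \sum_(u in heavy_nbrs v) share u <= \sum_(u in heavy_nbrs v) 2.
      apply: leq_sum => u uv; apply: (leq_trans (leq_subr _ _)).
      by rewrite leqNgt; apply/negP => h; apply: no; exists u.
    rewrite sum_nat_const; lia.
  rewrite (bigD1 u1) //=.
  have r1 : 10 <= retained v u1.
    apply: leq_trans (ret0 u1 u1v).
    have := degK_heavy u1; rewrite /demand; case: ifP => // _.
    by case: eqP => [->|_ _]; [lia | case: ifP].
  have : \sum_(u in heavy_nbrs v | u != u1) 6 <= \sum_(u in heavy_nbrs v | u != u1) retained v u.
    apply: leq_sum => u /andP[/ret0 h _]; apply: leq_trans h.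
    by have := demand_le u v; rewrite shv; lia.
  rewrite (eq_bigl (mem (heavy_nbrs v :\ u1))); last by move=> u; rewrite !inE andbC.
  rewrite sum_nat_const; have := cardsD1 u1 (heavy_nbrs v); rewrite u1v n6'; lia.
(* The share of [v] is at most 3, so nobody demands anything from it. *)
have ret0 u : u \in heavy_nbrs v -> 12 + demand v u <= retained v u.
  by move/ret; have := demand_le u v; rewrite shv; lia.
have low : 12 * #|heavy_nbrs v| + \sum_(u in heavy_nbrs v) demand v u <=
    \sum_(u in heavy_nbrs v) retained v u.
  by rewrite mulnC -sum_nat_const -big_split /=; exact: leq_sum.
have [n4|n3] := leqP 4 #|heavy_nbrs v|; first by lia.
have dem u : u \in heavy_nbrs v -> demand v u =
    if #|heavy_nbrs v| == 2 then 12 - 2 * deg v - 3 * #|nbrs3 v|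
    else if [&& #|heavy_nbrs v| == 3, deg v == 3 & 4 <= share u] then 2 else 0.
  by move=> uv; rewrite /demand vK nhv uv.
move oE: #|heavy_nbrs v| => o; rewrite oE in n3 dE low dem.
case: o n3 oE dE low dem => [|[|[|[|]]]] // _ oE dE low dem.
- by move: sS; rewrite big1; [lia | move=> u; rewrite (cards0_eq oE) inE].
- have /eqP/cards1P[u uE] := oE.
  by rewrite uE big_set1 in sS; have := share_le u; lia.
(* The formula in [demand] is half of what 24 + 4 * #|nbrs2 v| + 10 * #|nbrs3 v| lacks to 40. *)
- have : \sum_(u in heavy_nbrs v) demand v u = 2 * (12 - 2 * deg v - 3 * #|nbrs3 v|).
    by rewrite (eq_bigr _ dem) sum_nat_const oE.
  by lia.
- have [d4|d3] := ltnP 3 (deg v); first by lia.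
  have d3' : deg v = 3 by lia.
  pose T := [set u in heavy_nbrs v | 4 <= share u].
  have TE u : (u \in heavy_nbrs v) && (4 <= share u) = (u \in T) by rewrite [RHS]inE.
  have TC u : (u \in heavy_nbrs v) && ~~ (4 <= share u) = (u \in heavy_nbrs v :\: T).
    by rewrite finset.in_setD -TE; case: (_ \in _); case: (_ <= _).
  have : 2 * #|T| <= \sum_(u in heavy_nbrs v) demand v u.
    rewrite mulnC -sum_nat_const [leqRHS](bigID (fun u => 4 <= share u)) /=.
    rewrite -[leqLHS]addn0; apply: leq_add => //.
    rewrite (eq_bigl _ _ TE).
    apply: leq_sum => u; rewrite -TE => /andP[/dem -> s4].
    by rewrite d3' s4.
  (* The three heavy edges give 36, and two demands of 2 are missing. With a single neighbour of
     share at least 4 the shares would sum to at most D + 3 + 3. *)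
  have : 2 <= #|T|.
    rewrite leqNgt; apply/negP => T1; move: sS.
    rewrite (bigID (fun u => 4 <= share u)) /=.
    have h1 : \sum_(u in heavy_nbrs v | 4 <= share u) share u <= #|T| * D.
      rewrite (eq_bigl _ _ TE) -sum_nat_const.
      by apply: leq_sum => u _; exact: share_le.
    have h2 : \sum_(u in heavy_nbrs v | ~~ (4 <= share u)) share u <=
        #|heavy_nbrs v :\: T| * 3.
      rewrite (eq_bigl _ _ TC) -sum_nat_const.
      by apply: leq_sum => u; rewrite -TC -ltnNge => /andP[_].
    have := cardsID T (heavy_nbrs v).
    have -> : heavy_nbrs v :&: T = T.
      by apply/finset.setIidPr/fintype.subsetP => u; rewrite inE => /andP[].
    rewrite oE; move: T1 h1 h2; case: #|T| => [|[|]] // _; lia.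
  lia.
Qed.

(** * Weights of edges and of short cycles *)

Lemma demand_bound v u : demand v u <= 8.
Proof.
rewrite /demand; case: ifP => // _; have := deg_split v.
by case: eqP => [->|_]; [lia | case: ifP].
Qed.

(** Both neighbours of such a vertex are hubs, by [double_hub_nbr]; only such a vertex can demand
    more than 6. *)
Definition double_hub (v : V) : bool := (v \in K) && (deg v == 2).

Lemma demand_not_double_hub v u : ~~ double_hub v -> demand v u <= 6.
Proof.
rewrite /demand /double_hub; case: ifP => // /andP[vK _]; rewrite vK /=.
have := deg_split v; case: (#|heavy_nbrs v| =P 2) => [->|_]; last by case: ifP.
by move=> h /eqP h'; lia.
Qed.

Lemma light_nonhub v : light2 v || light3 v -> ~~ hub v.
Proof.
have := degK_le v; rewrite /light2 /light3 /hub.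
by move=> h /orP[] /andP[_ /eqP h']; lia.
Qed.

Lemma light_nbr v u : e v u -> light2 v || light3 v -> ~~ light2 u && ~~ light3 u.
Proof.
move=> vu lv; have vK : v \notin K by case/orP: lv => /andP[].
by have [uK _] := outK vu vK; rewrite /light2 /light3 uK.
Qed.

(** Without a hub, a demand only moves an amount from one end to the other, so the edge keeps the
    uniform weight 8 = 40 / 5. *)
Lemma retained_nonhub u v : e u v -> ~~ hub u -> ~~ hub v ->
  retained u v + retained v u = 24.
Proof.
move=> uv /negbTE hu /negbTE hv; rewrite /retained hu hv.
have lu := light_nbr uv; have := demand_bound u v; have := demand_bound v u.
case: (boolP (light2 u)) lu => [l2|_] lu.
  by have /andP[/negbTE-> /negbTE->] := lu isT.
case: (boolP (light3 u)) lu => [l3|_] lu.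
  by have /andP[/negbTE-> /negbTE->] := lu isT.
by case: (light2 v) => //; case: (light3 v) => //; lia.
Qed.

Lemma retained_hub u v : hub u -> hub v -> retained u v + retained v u = 12.
Proof.
move=> hu hv; have l w : hub w -> light2 w = false.
  by move=> hw; apply/negbTE; apply: contraL hw => lw; apply: light_nonhub; rewrite lw.
by rewrite /retained hu hv !l.
Qed.

Lemma retained_hub_light u v : hub u -> light2 v || light3 v ->
  retained u v + retained v u = 20.
Proof.
move=> hu lv; rewrite /retained hu (negbTE (light_nonhub lv)).
case/orP: lv => l; rewrite l //.
have -> : light2 v = false by move: l => /andP[_ /eqP dv]; rewrite /light2 dv andbF.
by [].
Qed.

Lemma retained_hub_heavy u v : hub u -> ~~ hub v -> ~~ light2 v -> ~~ light3 v ->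
  retained u v + retained v u = 18 + demand v u.
Proof.
move=> hu /negbTE hv /negbTE l2 /negbTE l3; rewrite /retained hu hv l2 l3.
have -> : light2 u = false.
  by apply/negbTE; apply: contraL hu => lw; apply: light_nonhub; rewrite lw.
have -> : light3 u = false.
  by apply/negbTE; apply: contraL hu => lw; apply: light_nonhub; rewrite lw orbT.
by lia.
Qed.

Lemma weight_sym u v : weight u v = weight v u.
Proof. by rewrite /weight addnC. Qed.

Lemma weight_hub_heavy u v : hub u -> ~~ hub v -> ~~ light2 v -> ~~ light3 v ->
  weight u v = (22 - demand v u)./2.
Proof. by move=> *; rewrite /weight retained_hub_heavy //; congr _./2; lia. Qed.

Lemma weight_hub u v : hub u -> hub v -> weight u v = 14.
Proof. by move=> *; rewrite /weight retained_hub. Qed.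

Lemma weight_hub_light u v : hub u -> light2 v || light3 v -> weight u v = 10.
Proof. by move=> *; rewrite /weight retained_hub_light. Qed.

Lemma weight_nonhub u v : e u v -> ~~ hub u -> ~~ hub v -> weight u v = 8.
Proof. by move=> *; rewrite /weight retained_nonhub. Qed.

(** Up to symmetry these are the four kinds of edges for which [weight] has been computed. *)
Lemma edge_ind (Q : V -> V -> Prop) :
  (forall u v, Q u v -> Q v u) ->
  (forall u v, e u v -> ~~ hub u -> ~~ hub v -> Q u v) ->
  (forall u v, hub u -> hub v -> Q u v) ->
  (forall u v, hub u -> light2 v || light3 v -> Q u v) ->
  (forall u v, e u v -> hub u -> ~~ hub v -> ~~ light2 v -> ~~ light3 v -> Q u v) ->
  forall u v, e u v -> Q u v.
Proof.
move=> Qsym Q1 Q2 Q3 Q4.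
have half u v : e u v -> hub u -> Q u v.
  move=> uv hu; have [hv|hv] := boolP (hub v); first exact: Q2.
  have [lv|] := boolP (light2 v || light3 v); first exact: Q3.
  by rewrite negb_or => /andP[]; exact: Q4.
move=> u v uv; have [hu|hu] := boolP (hub u); first exact: half.
have [hv|hv] := boolP (hub v); last exact: Q1.
by apply/Qsym/half => //; rewrite e_sym.
Qed.

(** The subtraction in [weight] is truncated, so the point is that the two retained parts never
    exceed 40. *)
Lemma weight_retained u v : e u v -> 2 * weight u v + retained u v + retained v u <= 40.
Proof.
move=> uv.
suff : retained u v + retained v u <= 40 by rewrite /weight; lia.
move: u v uv; apply: edge_ind => [u v|u v uv hu hv|u v hu hv|u v hu lv|u v uv hu hv l2 l3].
- by rewrite addnC.
- by rewrite retained_nonhub.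
- by rewrite retained_hub.
- by rewrite retained_hub_light.
- by rewrite retained_hub_heavy //; have := demand_bound v u; lia.
Qed.

Lemma weight_ge7 u v : e u v -> 7 <= weight u v.
Proof.
move: u v; apply: edge_ind => [u v|u v uv hu hv|u v hu hv|u v hu lv|u v uv hu hv l2 l3].
- by rewrite weight_sym.
- by rewrite weight_nonhub.
- by rewrite weight_hub.
- by rewrite weight_hub_light.
- by rewrite weight_hub_heavy //; have := demand_bound v u; lia.
Qed.

Lemma weight_ge8 u v : e u v -> ~~ double_hub u -> ~~ double_hub v -> 8 <= weight u v.
Proof.
move: u v; apply: edge_ind =>
  [u v h nv nu|u v uv hu hv|u v hu hv|u v hu lv|u v uv hu hv l2 l3 nu nv].
- by rewrite weight_sym h.
- by rewrite weight_nonhub.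
- by rewrite weight_hub.
- by rewrite weight_hub_light.
- by rewrite weight_hub_heavy //; have := demand_not_double_hub u nv; lia.
Qed.

Lemma share_degK v : share v <= degK v. Proof. exact: leq_subr. Qed.

(** Both neighbours must be heavy to reach D + 7; as one has share at most [D], the other has share
    at least 7. *)
Lemma double_hub_nbr v u : double_hub v -> e v u -> hub u.
Proof.
case/andP=> vK /eqP d2 vu; have dE := deg_split v; have sS := share_split vK.
have n2 : #|heavy_nbrs v| = 2.
  have [n0|n0] := posnP #|heavy_nbrs v|.
    by move: sS; rewrite big1; [lia | move=> w; rewrite (cards0_eq n0) inE].
  have [n1||//] := ltngtP #|heavy_nbrs v| 2; last by lia.
  have /eqP/cards1P[w wE] : #|heavy_nbrs v| = 1 by lia.
  by rewrite wE big_set1 cards1 in sS dE; have := share_le w; lia.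
have hE : heavy_nbrs v = nbrs v.
  apply/eqP; rewrite eqEcard n2 -/(deg v) d2 leqnn andbT.
  by apply/fintype.subsetP => w; rewrite inE => /andP[].
have uv : u \in heavy_nbrs v by rewrite hE in_nbrs.
have := sum_heavy_le uv n2; have := share_degK u; rewrite /hub; lia.
Qed.

(* The vertices, other than double hubs, that may demand more than 4. *)
Definition needy (p : V) : bool :=
  [&& p \in K, deg p == 3, #|heavy_nbrs p| == 2 & #|nbrs3 p| == 0].

Lemma weight_hub_ge9 y p : e y p -> hub y -> ~~ double_hub p -> ~~ needy p ->
  9 <= weight y p.
Proof.
move=> yp hy np nn; have [hp|hp] := boolP (hub p); first by rewrite weight_hub.
have [lp|] := boolP (light2 p || light3 p); first by rewrite weight_hub_light.
rewrite negb_or => /andP[l2 l3]; rewrite weight_hub_heavy //.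
suff : demand p y <= 4 by lia.
have dE := deg_split p; rewrite /demand; case: ifP => // /andP[pK _].
move: np nn; rewrite /double_hub /needy pK /=.
case: (#|heavy_nbrs p| =P 2) => [n2|_]; last by case: ifP.
by move: dE; rewrite n2 /=; lia.
Qed.

(** The neighbours of [p] other than its two heavy ones number one, of share 1. If [q] is heavy, its
    share is therefore at least 6, so it has too many heavy neighbours to demand anything from
    [x]. *)
Lemma weight_needy p q x : needy p -> e p q -> e q x -> hub x -> 10 <= weight q x.
Proof.
case/and4P=> pK /eqP d3 /eqP n2 /eqP n3 pq qx hx; rewrite weight_sym.
have [hq|hq] := boolP (hub q); first by rewrite weight_hub.
have [lq|] := boolP (light2 q || light3 q); first by rewrite weight_hub_light.
rewrite negb_or => /andP[l2 l3]; rewrite weight_hub_heavy // demand_heavy //.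
have qp : q \in heavy_nbrs p by rewrite inE in_nbrs pq l2.
have := sum_heavy_le qp n2; have := share_split pK; have := deg_split p.
have := degK_heavy q; have := share_degK q; lia.
Qed.

Lemma leq_add5 a b c d f a' b' c' d' f' :
  a <= a' -> b <= b' -> c <= c' -> d <= d' -> f <= f' ->
  a + b + c + d + f <= a' + b' + c' + d' + f'.
Proof. by move=> *; rewrite !leq_add. Qed.

(** The edges at [v] may weigh only 7 each, so the other three must make up 26. They do so by an
    edge of weight 14 between hubs, or as 8 + 8 + 10 beside a needy vertex, or as 9 + 8 + 9. *)
Lemma double_hub_cycle_weight x v y p q : double_hub v ->
  e x v -> e v y -> e y p -> e p q -> e q x ->
  40 <= weight x v + weight v y + weight y p + weight p q + weight q x.
Proof.
move=> dv xv vy yp pq qx.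
have vx : e v x by rewrite e_sym.
have py : e p y by rewrite e_sym.
have qp : e q p by rewrite e_sym.
have xq : e x q by rewrite e_sym.
have hx := double_hub_nbr dv vx; have hy := double_hub_nbr dv vy.
have w1 := weight_ge7 xv; have w2 := weight_ge7 vy.
have w3 := weight_ge7 yp; have w4 := weight_ge7 pq; have w5 := weight_ge7 qx.
have [dp|np] := boolP (double_hub p).
  have {w5}w5 : 14 <= weight q x by rewrite weight_hub // (double_hub_nbr dp).
  exact: leq_trans (leq_add5 w1 w2 w3 w4 w5).
have [dq|nq] := boolP (double_hub q).
  have {w3}w3 : 14 <= weight y p by rewrite weight_hub // (double_hub_nbr dq).
  exact: leq_trans (leq_add5 w1 w2 w3 w4 w5).
have nv z : hub z -> ~~ double_hub z.
  rewrite /hub => hz; apply/negP => /andP[_ /eqP d2].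
  by have := leq_trans hz (degK_le z); rewrite d2.
have {w4}w4 := weight_ge8 pq np nq.
have {w3}w3 := weight_ge8 yp (nv _ hy) np.
have {w5}w5 := weight_ge8 qx nq (nv _ hx).
have [tp|tp] := boolP (needy p).
  exact: leq_trans (leq_add5 w1 w2 w3 w4 (weight_needy tp pq qx hx)).
have [tq|tq] := boolP (needy q).
  have {w3}w3 := weight_needy tq qp py hy; rewrite weight_sym in w3.
  exact: leq_trans (leq_add5 w1 w2 w3 w4 w5).
have {w3}w3 := weight_hub_ge9 yp hy np tp.
have {w5}w5 := weight_hub_ge9 xq hx nq tq; rewrite weight_sym in w5.
exact: leq_trans (leq_add5 w1 w2 w3 w4 w5).
Qed.

Lemma cycle5_weight x v y p q :
  e x v -> e v y -> e y p -> e p q -> e q x ->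
  40 <= weight x v + weight v y + weight y p + weight p q + weight q x.
Proof.
move=> xv vy yp pq qx.
have rot (a b c d f : nat) : a + b + c + d + f = b + c + d + f + a.
  by rewrite -!addnA addnC !addnA.
have [dv|nv] := boolP (double_hub v); first exact: double_hub_cycle_weight.
have [dy|ny] := boolP (double_hub y).
  by rewrite rot; exact: double_hub_cycle_weight.
have [dp|np] := boolP (double_hub p).
  by do 2 rewrite rot; exact: double_hub_cycle_weight.
have [dq|nq] := boolP (double_hub q).
  by do 3 rewrite rot; exact: double_hub_cycle_weight.
have [dx|nx] := boolP (double_hub x).
  by do 4 rewrite rot; exact: double_hub_cycle_weight.
by apply: (@leq_add5 8 8 8 8 8); apply: weight_ge8.
Qed.

Lemma edge_weight_seq (m : V -> V -> nat) (S : rel V) (l : seq (V * V)) :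
  uniq l -> all (fun p => S p.1 p.2) l ->
  \sum_(p <- l) m p.1 p.2 <= edge_weight m S.
Proof.
move=> ul /allP Sl; rewrite /edge_weight pair_big_dep /= big_uniq //=.
rewrite [leqRHS](bigID (mem l)) /= -[leqLHS]addn0; apply: leq_add => //.
have lE p : S p.1 p.2 && (p \in l) = (p \in l).
  by case: (boolP (p \in l)) => pl; rewrite ?andbF // Sl.
by rewrite (eq_bigl _ _ lE).
Qed.

Hypothesis no_triangle : forall a b c, e a b -> e b c -> e c a -> False.
Hypothesis no_square : forall a b c d,
  e a b -> e b c -> e c d -> e d a -> a != c -> b != d -> False.

(** A nonempty even subgraph either contains a 5-cycle, treated by [cycle5_weight], or has six
    edges, of weight at least 6 * 7 = 42; no whole cycle need be extracted in the second case. *)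
Lemma even_subgraph_weight S : even_subgraph e S -> 2 * 40 <= edge_weight weight S.
Proof.
case=> Ssym Se [v0 [v1 s01]] Seven.
have next u x : S u x -> exists2 y, y != x & S u y.
  move=> ux; apply: contrapT => no.
  have : [set y : V | S u y] = [set x].
    apply/setP => y; rewrite !inE; apply/idP/eqP => [uy|->//].
    by apply/eqP; apply: contraT => yx; case: no; exists y.
  by move=> E; have := Seven u; rewrite E cards1.
have ne u v : S u v -> u != v by apply: contraTneq => ->; apply/negP => /Se; rewrite e_irr.
have S' u v : S u v -> S v u by rewrite Ssym.
have s10 := S' _ _ s01; have [v2 n20 s12] := next _ _ (S' _ _ s01).
have [v3 n31 s23] := next _ _ (S' _ _ s12).
have [v4 n42 s34] := next _ _ (S' _ _ s23).
have tri a b c d : S a b -> S b c -> S c d -> d != a.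
  move=> ab bc cd; apply/eqP => da; subst d.
  exact: no_triangle (Se _ _ ab) (Se _ _ bc) (Se _ _ cd).
have sq a b c d x : S a b -> S b c -> S c d -> S d x -> c != a -> d != b -> x != a.
  move=> ab bc cd dx ca db; apply/eqP => xa; subst x.
  by apply: (no_square (Se _ _ ab) (Se _ _ bc) (Se _ _ cd) (Se _ _ dx)); rewrite eq_sym.
have s21 := S' _ _ s12; have s32 := S' _ _ s23; have s43 := S' _ _ s34.
have n30 := tri _ _ _ _ s01 s12 s23; have n41 := tri _ _ _ _ s12 s23 s34.
have n40 := sq _ _ _ _ _ s01 s12 s23 s34 n20 n31.
have n10 : v1 != v0 by rewrite eq_sym ne.
have n21 : v2 != v1 by rewrite eq_sym ne.
have n32 : v3 != v2 by rewrite eq_sym ne.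
have n43 : v4 != v3 by rewrite eq_sym ne.
have u5 : uniq [:: v0; v1; v2; v3; v4].
  by rewrite /= !inE !negb_or ![v0 == _]eq_sym (eq_sym v1 v2) (eq_sym v1 v3)
    (eq_sym v1 v4) (eq_sym v2 v3) (eq_sym v2 v4) (eq_sym v3 v4)
    n10 n20 n30 n40 n21 n31 n41 n32 n42 n43.
pose at_ s (ij : nat * nat) : V * V := (nth v0 s ij.1, nth v0 s ij.2).
have at_uniq s (l : seq (nat * nat)) : uniq s ->
    all (fun ij => (ij.1 < size s) && (ij.2 < size s)) l -> uniq l -> uniq (map (at_ s) l).
  move=> us /allP sl; rewrite map_inj_in_uniq // => -[i j] [i' j'].
  move=> /sl /andP[/= hi hj] /sl /andP[/= hi' hj'] [/eqP + /eqP].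
  by rewrite !nth_uniq // => /eqP-> /eqP->.
have cycle5 : S v4 v0 -> 2 * 40 <= edge_weight weight S.
  move=> s40.
  (* Both orientations are listed, since [edge_weight] counts ordered pairs. *)
  pose l := [:: (0, 1); (1, 2); (2, 3); (3, 4); (4, 0); (1, 0); (2, 1); (3, 2); (4, 3); (0, 4)].
  have ul : uniq (map (at_ [:: v0; v1; v2; v3; v4]) l) by apply: at_uniq.
  apply: leq_trans (edge_weight_seq weight ul _); last first.
    by rewrite /= s01 s12 s23 s34 s40 s10 s21 s32 s43 (S' _ _ s40).
  rewrite big_map !big_cons big_nil /=.
  rewrite (weight_sym v1 v0) (weight_sym v2 v1) (weight_sym v3 v2).
  rewrite (weight_sym v4 v3) (weight_sym v0 v4).
  have := cycle5_weight (Se _ _ s01) (Se _ _ s12) (Se _ _ s23) (Se _ _ s34) (Se _ _ s40).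
  move: (weight v0 v1) (weight v1 v2) (weight v2 v3) (weight v3 v4) (weight v4 v0).
  by clear; lia.
have [v5 n53 s45] := next _ _ (S' _ _ s34).
have n52 := tri _ _ _ _ s23 s34 s45; have n51 := sq _ _ _ _ _ s12 s23 s34 s45 n31 n42.
have n54 : v5 != v4 by rewrite eq_sym ne.
have [e50|n50] := eqVneq v5 v0; first by apply: cycle5; rewrite -e50.
have u6 : uniq [:: v0; v1; v2; v3; v4; v5].
  rewrite -[[:: v0; _; _; _; _; _]]/(rcons [:: v0; v1; v2; v3; v4] v5) rcons_uniq u5 andbT.
  by rewrite !inE !negb_or n50 n51 n52 n53.
(* The walk is also continued backwards from [v0]. Girth forbids [w] among the vertices up to [v3],
   [w = v4] closes a 5-cycle, and otherwise the edge from [w] to [v0] is a sixth one, closing a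
   6-cycle when [w = v5]. *)
have [w nw1 s0w] := next _ _ s01.
have w0 : w != v0 by rewrite eq_sym ne.
have w2 : w != v2 by rewrite eq_sym (tri _ _ _ _ (S' _ _ s0w) s01 s12).
have w3 : w != v3.
  by rewrite eq_sym (sq _ _ _ _ _ (S' _ _ s0w) s01 s12 s23) // eq_sym.
have [w4|w4] := eqVneq w v4; first by apply: cycle5; rewrite Ssym -w4.
have six (l : seq (V * V)) : uniq l -> size l = 12 -> all (fun p => S p.1 p.2) l ->
    2 * 40 <= edge_weight weight S.
  move=> ul sl /[dup] Sl /allP Sl'; apply: leq_trans (edge_weight_seq weight ul Sl).
  apply: (@leq_trans (\sum_(p <- l) 7)); first by rewrite big_const_seq count_predT sl.
  by rewrite big_seq [leqRHS]big_seq; apply: leq_sum => p /Sl'/Se/weight_ge7.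
have [w5|w5] := eqVneq w v5.
  pose l := [:: (0, 1); (1, 2); (2, 3); (3, 4); (4, 5); (5, 0);
    (1, 0); (2, 1); (3, 2); (4, 3); (5, 4); (0, 5)].
  apply: (six (map (at_ [:: v0; v1; v2; v3; v4; v5]) l)) => //; first exact: at_uniq.
  by rewrite /= s01 s12 s23 s34 s45 -w5 s0w s10 s21 s32 s43 (S' _ _ s0w) w5 (S' _ _ s45).
pose l := [:: (0, 1); (1, 2); (2, 3); (3, 4); (4, 5); (6, 0);
  (1, 0); (2, 1); (3, 2); (4, 3); (5, 4); (0, 6)].
apply: (six (map (at_ [:: v0; v1; v2; v3; v4; v5; w]) l)) => //.
  apply: at_uniq => //.
  rewrite -[[:: v0; _; _; _; _; _; _]]/(rcons [:: v0; v1; v2; v3; v4; v5] w) rcons_uniq u6 andbT.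
  by rewrite !inE !negb_or w0 nw1 w2 w3 w4 w5.
by rewrite /= s01 s12 s23 s34 s45 s0w s10 s21 s32 s43 (S' _ _ s0w) (S' _ _ s45).
Qed.

(** Adding [weight_retained] over all ordered pairs and using [retained_sum] twice contradicts
    [weighted_euler] with t = 40, by the term 2 * t. *)
Lemma no_dischargeable_graph : has_dual e -> (exists u v, e u v) -> False.
Proof.
move=> dual edge.
have := weighted_euler e_sym e_irr dual weight_sym even_subgraph_weight edge.
set W := [set v : V | _].
have -> : \sum_v #|[set u : V | e v u]| = \sum_v \sum_(u | e v u) 1.
  by apply: eq_bigr => v _; rewrite sum1_card cardsE.
have ret : 40 * #|W| <= \sum_v \sum_(u | e v u) retained v u.
  rewrite mulnC -sum_nat_const [leqRHS](bigID (mem W)) /= -[leqLHS]addn0.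
  apply: leq_add => //; apply: leq_sum => v; rewrite inE => /existsP[u vu].
  have := @retained_sum v; rewrite (eq_bigl (e v)); last by move=> x; rewrite in_nbrs.
  by apply; apply/set0Pn; exists u; rewrite in_nbrs.
have ret' : \sum_v \sum_(u | e v u) retained u v = \sum_v \sum_(u | e v u) retained v u.
  rewrite (exchange_big_dep predT) //=; apply: eq_bigr => v _.
  by apply: eq_bigl => u; rewrite e_sym.
have tot : 2 * edge_weight weight e + \sum_v \sum_(u | e v u) retained v u
    + \sum_v \sum_(u | e v u) retained u v <= 40 * \sum_v \sum_(u | e v u) 1.
  rewrite /edge_weight !big_distrr -!big_split /=; apply: leq_sum => v _.
  rewrite !big_distrr -!big_split /=; apply: leq_sum => u vu.
  by rewrite muln1; exact: weight_retained.
by move: ret' tot ret; lia.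
Qed.

End Discharging.

(** * Colouring *)

Section Core.
Variables (V : finType) (k : nat).

Definition near2 (e : rel V) (u v : V) : bool :=
  (u != v) && (e u v || [exists w, e u w && e w v]).

Definition proper_on (e : rel V) (X : {set V}) (c : V -> 'I_k) : Prop :=
  forall u v, u \in X -> v \in X -> near2 e u v -> c u != c v.

(** The middle vertex of a path in [near2] need not lie in [X]. A union of closed sets is closed,
    which makes [core] the largest one. *)
Definition core_closed (e : rel V) (X : {set V}) : bool :=
  [forall v in X, k <= #|[set u in X | near2 e v u]|].

Definition core (e : rel V) : {set V} := \bigcup_(X | core_closed e X) X.

Variable e : rel V.
Hypothesis e_sym : symmetric e.

Lemma near2_sym : symmetric (near2 e).
Proof.
move=> u v; rewrite /near2 eq_sym e_sym; congr (_ && (_ || _)).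
by apply: eq_existsb => w; rewrite andbC (e_sym u) (e_sym v).
Qed.

Lemma core_near2 v : v \in core e -> k <= #|[set u in core e | near2 e v u]|.
Proof.
case/bigcupP=> X Xcl vX; apply: leq_trans (forall_inP Xcl v vX) _.
apply/subset_leq_card/fintype.subsetP => u; rewrite !inE => /andP[uX ->].
by rewrite andbT; apply/bigcupP; exists X.
Qed.

(** A set that contains the core and is not closed has a vertex with fewer than [k] vertices of the
    set near it. It lies outside the core; it is removed, the rest is coloured, and a colour is left
    for it. *)
Lemma extend_from_core (c : V -> 'I_k) : proper_on e (core e) c ->
  exists c', proper_on e [set: V] c'.
Proof.
move=> cP; have [m] := ubnP #|[set: V]|.
have : core e \subset [set: V] by exact/fintype.subsetP.
elim: m [set: V] => // m IHm X coreX Xm.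
have [Xcl|] := boolP (core_closed e X).
  (* A closed [X] is contained in the core, where [c] is already proper. *)
  exists c => u v uX vX; apply: cP; apply/bigcupP; exists X => //.
rewrite negb_forall_in => /existsP[v /andP[vX]]; rewrite -ltnNge => few.
have vcore : v \notin core e.
  apply: contraL few => /core_near2 h; rewrite -leqNgt; apply: leq_trans h _.
  apply/subset_leq_card/fintype.subsetP => u; rewrite !inE => /andP[ucore ->].
  by rewrite (fintype.subsetP coreX).
have [||c' c'P] := IHm (X :\ v).
- by rewrite finset.subsetD1 coreX.
- by move: Xm; rewrite (cardsD1 v) vX.
pose used := [set c' u | u in [set u in X | near2 e v u]].
have [i iN] : exists i, i \notin used.
  apply/existsP; rewrite -negb_forall; apply/negP => /forallP all_used.
  have : k <= #|used|.
    by rewrite -[leqLHS]card_ord; apply/subset_leq_card/fintype.subsetP.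
  by move/leq_trans/(_ (leq_imset_card _ _)); rewrite leqNgt few.
exists (fun u => if u == v then i else c' u) => u w uX wX uw.
have fresh x : x \in X -> near2 e v x -> i != c' x.
  move=> xX vx; apply: contraNneq iN => ->; apply/imsetP.
  by exists x; rewrite // inE xX.
have [uv|uv] := eqVneq u v; have [wv|wv] := eqVneq w v.
- by move: uw; rewrite uv wv /near2 eqxx.
- by apply: fresh; rewrite -?uv.
- by rewrite eq_sym; apply: fresh; rewrite // near2_sym -?wv.
- by apply: c'P; rewrite ?inE ?uv ?wv.
Qed.

Definition delete_edge (a b : V) : rel V :=
  [rel u v | e u v && ([set u; v] != [set a; b])].

(* As a is outside the core, no path of length at most 2 through the edge ab
   joins two vertices of the core. *)
Lemma core_delete_edge (a b : V) (c : V -> 'I_k) :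
  a \notin core e -> (b \notin core e \/ forall x, e a x -> x = b) ->
  proper_on (delete_edge a b) [set: V] c -> proper_on e (core e) c.
Proof.
move=> aC bC cP u v uC vC /andP[uv con]; apply: cP; rewrite ?inE //.
rewrite /near2 uv /=.
have neq x : x \in core e -> x != a by apply: contraTneq => ->.
have pair x y : x \in core e -> [set x; y] = [set a; b] -> x = b /\ y = a.
  move=> xC E; have xab : x \in [set a; b]%SET by rewrite -E set21.
  have axy : a \in [set x; y]%SET by rewrite E set21.
  move: xab axy; rewrite !inE (negbTE (neq x xC)) (eq_sym a x) (negbTE (neq x xC)) /=.
  by move=> /eqP-> /eqP->.
case/orP: con => [euv|/existsP[w /andP[uw wv]]].
  apply/orP; left; rewrite /delete_edge /= euv; apply/eqP => /(pair _ _ uC)[_ va].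
  by have := neq v vC; rewrite va eqxx.
have bad x y : x \in core e -> y \in core e -> x != y -> e x w -> e w y ->
    [set x; w] != [set a; b].
  move=> xC yC xy xw wy; apply/eqP => /(pair _ _ xC)[xb wa].
  case: bC => [bC|only]; first by rewrite -xb xC in bC.
  by move: xy; rewrite xb (only y) ?eqxx // -wa.
apply/orP; right; apply/existsP; exists w.
rewrite /delete_edge /= uw wv (bad u v) //=.
by rewrite finset.setUC (bad v u) // 1?eq_sym // e_sym.
Qed.

Lemma colorable_delete_edge (a b : V) : a \notin core e ->
  (b \notin core e \/ forall x, e a x -> x = b) ->
  (exists c : V -> 'I_k, proper_on (delete_edge a b) [set: V] c) ->
  exists c : V -> 'I_k, proper_on e [set: V] c.
Proof. by move=> aC bC [c /(core_delete_edge aC bC)]; exact: extend_from_core. Qed.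

(* Each vertex of K at distance at most 2 from v is either a neighbour of v or
   reached through a neighbour w of v. *)
Lemma card_near2_le (K : {set V}) (v : V) : v \in K ->
  #|[set u in K | near2 e v u]| <= \sum_(u in nbrs e v) share e K u.
Proof.
move=> vK; pose T w := (nbrs e w :&: K :\ v) :|: ([set w] :&: K).
have Tle w : w \in nbrs e v -> #|T w| <= share e K w.
  rewrite in_nbrs => vw; apply: leq_trans (leq_card_setU _ _) _.
  have vw' : v \in nbrs e w :&: K by rewrite finset.in_setI in_nbrs e_sym vw.
  have := cardsD1 v (nbrs e w :&: K); rewrite vw' /share -/(degK e K w) => ->.
  have [wK|wK] := boolP (w \in K).
    rewrite subn0 addnC leq_add2r; apply: leq_trans (subset_leq_card (finset.subsetIl _ _)) _.
    by rewrite cards1.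
  have -> : [set w]%SET :&: K = finset.set0.
    by apply/setP => z; rewrite !inE; case: eqP => // ->; exact/negbTE.
  by rewrite cards0 addn0 addKn.
apply: (@leq_trans (\sum_(w in nbrs e v) #|T w|)); last exact: leq_sum.
rewrite -sum1_card; under [leqRHS]eq_bigr do rewrite -sum1_card big_mkcond /=.
rewrite exchange_big /= [leqLHS]big_mkcond /=; apply: leq_sum => u _.
case: ifP => //; rewrite inE => /andP[uK /andP[vu con]].
have [w vw uT] : exists2 w, w \in nbrs e v & u \in T w.
  case/orP: con => [evu|/existsP[w /andP[vw wu]]]; [exists u | exists w];
    rewrite ?in_nbrs // /T !inE ?eqxx ?uK ?andbT ?orbT //.
  by rewrite eq_sym vu wu.
by rewrite (bigD1 w) //= uT.
Qed.

End Core.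

(** * Induction on the number of edges *)

Section Main.
Variable R : realType.

Lemma girth5_no_triangle (G : sgraph) (a b c : G) : girth_ge G 5 ->
  adj a b -> adj b c -> adj c a -> False.
Proof.
move=> g5 ab bc ca; have cyc : has_cycle G 3.
  apply/andP; split=> //; apply/existsP; exists [tuple a; b; c].
  have ne (x y : G) : adj x y -> x != y.
    by apply: contraTneq => ->; rewrite adj_irrefl.
  by rewrite /ucycleb /= ab bc ca !inE negb_or !ne // adj_sym.
move: g5; rewrite /girth_ge /girth; case: pselect => [h|[]]; last by exists 3.
by case: ex_minnP => g _ gmin; have := gmin _ cyc; lia.
Qed.

Lemma girth5_no_square (G : sgraph) (a b c d : G) : girth_ge G 5 ->
  adj a b -> adj b c -> adj c d -> adj d a -> a != c -> b != d -> False.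
Proof.
move=> g5 ab bc cd da ac bd; have cyc : has_cycle G 4.
  apply/andP; split=> //; apply/existsP; exists [tuple a; b; c; d].
  have ne (x y : G) : adj x y -> x != y.
    by apply: contraTneq => ->; rewrite adj_irrefl.
  rewrite /ucycleb /= ab bc cd da !inE !negb_or ac bd !ne //.
  by rewrite adj_sym.
move: g5; rewrite /girth_ge /girth; case: pselect => [h|[]]; last by exists 4.
by case: ex_minnP => g _ gmin; have := gmin _ cyc; lia.
Qed.

(** [D] is only an upper bound for the degrees: deleting an edge may lower the maximum degree, while
    the number of colours has to stay the same. *)
Lemma planar_proper_coloring (V : finType) (D n : nat) (e : rel V)
    (e_sym : symmetric e) (e_irr : irreflexive e) :
  planar R (SGraph e_sym e_irr) ->
  (forall a b c, e a b -> e b c -> e c a -> False) ->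
  (forall a b c d, e a b -> e b c -> e c d -> e d a -> a != c -> b != d -> False) ->
  (forall v, deg e v <= D) -> #|[set p : V * V | e p.1 p.2]| <= n ->
  exists c : V -> 'I_(D + 7), proper_on e [set: V] c.
Proof.
elim: n e e_sym e_irr => [|n IHn] e e_sym e_irr planar_e no3 no4 degD en.
  have i0 : 'I_(D + 7) by rewrite addnS; exact: ord0.
  have e0 u v : e u v = false.
    apply/negP => uv; move: en; rewrite leqn0 => /eqP/cards0_eq/setP/(_ (u, v)).
    by rewrite !inE uv.
  exists (fun _ => i0) => u v _ _ /andP[_]; rewrite e0 /= => /existsP[w].
  by rewrite e0.
(* Such an edge can be deleted, by [colorable_delete_edge]; if there is none, the hypothesis [outK]
   of the discharging holds. *)
have [[a [b [ab aC bC]]]|no] := pselect (exists a b, [/\ e a b, a \notin core (D + 7) e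
    & b \notin core (D + 7) e \/ forall x, e a x -> x = b]).
  apply: (colorable_delete_edge e_sym aC bC).
  have sub u v : delete_edge e a b u v -> e u v by case/andP.
  have e'_sym : symmetric (delete_edge e a b).
    by move=> u v; rewrite /delete_edge /= e_sym finset.setUC.
  have e'_irr : irreflexive (delete_edge e a b).
    by move=> u; rewrite /delete_edge /= e_irr.
  apply: (IHn _ e'_sym e'_irr).
  - case: planar_e => pt [arc [h1 h2 h3 h4 h5]]; exists pt, arc; split=> //.
    + by move=> u v /sub; exact: h3.
    + by move=> u v w /sub; exact: h4.
    + by move=> u v u' v' /sub h /sub h'; exact: h5.
  - by move=> x y z /sub xy /sub yz /sub; exact: no3 xy yz.
  - by move=> x y z t /sub xy /sub yz /sub zt /sub; exact: no4 xy yz zt.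
  - move=> v; apply: leq_trans (degD v); apply/subset_leq_card/fintype.subsetP => u.
    by rewrite !in_nbrs => /sub.
  - rewrite -ltnS; apply: leq_trans en; apply: proper_card; apply/properP; split.
      by apply/fintype.subsetP => p; rewrite !inE => /sub.
    by exists (a, b); rewrite inE /= ?ab // /delete_edge /= eqxx andbF.
have outK a b : e a b -> a \notin core (D + 7) e ->
    b \in core (D + 7) e /\ exists2 x, x != b & e a x.
  move=> ab aC; split.
    by apply: contrapT => /negP bC; apply: no; exists a, b; split=> //; left.
  apply: contrapT => only; apply: no; exists a, b; split=> //; right=> x ax.
  by apply/eqP; apply: contrapT => /negP xb; apply: only; exists x.
have [edge|noedge] := pselect (exists u v, e u v).
  case: (no_dischargeable_graph e_sym e_irr degD outK _ no3 no4 _ edge).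
    move=> v vK; apply: leq_trans (card_near2_le e_sym vK).
    exact: core_near2.
  exact: planar_has_dual planar_e.
have i0 : 'I_(D + 7) by rewrite addnS; exact: ord0.
exists (fun _ => i0) => u v _ _ /andP[_ /orP[uv|/existsP[w /andP[uw _]]]].
  by case: noedge; exists u, v.
by case: noedge; exists u, w.
Qed.

Lemma dist_le2_near2 (G : sgraph) (u v : G) :
  u != v -> dist_le 2 u v -> near2 (@adj G) u v.
Proof.
move=> uv /existsP[n /existsP[p /andP[pth /eqP]]]; rewrite /near2 uv /=.
case: n p pth => [[|[|[|]]]] // i p; rewrite /=.
- by rewrite (tuple0 p) /= => _ uvE; rewrite uvE eqxx in uv.
- by case/tupleP: p => x p; rewrite (tuple0 p) /= andbT => ux <-; rewrite ux.
- case/tupleP: p => x p; case/tupleP: p => y p; rewrite (tuple0 p) /= andbT.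
  by move=> /andP[ux xy] <-; apply/orP; right; apply/existsP; exists x; rewrite ux.
Qed.

End Main.

Theorem theorem1p4 (R : realType) (G : sgraph)
  (planarG : planar R G) (girthG : girth_ge G 5) :
  (chi2 G <= max_degree G + 7)%N.
Proof.
have [c cP] : exists c : G -> 'I_(max_degree G + 7), proper_on (@adj G) [set: G] c.
  apply: (@planar_proper_coloring R _ _ _ (@adj G) (@adj_sym G) (@adj_irrefl G)) (leqnn _).
  (* Destructing [G] identifies it with the record rebuilt from its fields. *)
  - by case: G planarG girthG.
  - by move=> a b d; exact: girth5_no_triangle.
  - by move=> a b d f; exact: girth5_no_square.
  - move=> v; exact: (leq_bigmax (F := fun v : G => #|neighbors v|) v).
rewrite /chi2; case: ex_minnP => k _; apply.
apply/existsP; exists [ffun v => c v]; apply/forallP => u; apply/forallP => v.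
apply/implyP => /andP[uv duv]; rewrite !ffunE; apply: cP; rewrite ?inE //.
exact: dist_le2_near2.
Qed.
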